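(* Let $\alpha>-1$, let $n$ be a positive integer, $\lambda=e^{2\pi i/n}$, $\phi(z)=\lambda z$, and $\psi(z)=\sum_{k=0}^\infty\hat\psi_kz^k$ analytic on $\mathbb{D}$ with $C_{\psi,\phi}$ bounded on $L^2_a(dA_\alpha)$. Suppose $\hat\psi_{np+j}\ne0$ for some integers $p\ge0$ and $0<j<n$. Then $W(C_{\psi,\phi})$ contains the closed elliptical region with foci $\hat\psi_0$ and $\lambda^{np+j}\hat\psi_0$, whose major axis has length $\sqrt{|\hat\psi_0|^2|1-e^{2\pi ij/n}|^2+\frac{(np+j)!\,\Gamma(\alpha+2)}{\Gamma(np+j+\alpha+2)}|\hat\psi_{np+j}|^2}$ and whose minor axis has length $\sqrt{\frac{(np+j)!\,\Gamma(\alpha+2)}{\Gamma(np+j+\alpha+2)}}\,|\hat\psi_{np+j}|$.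
   Context: $\mathbb{D}$ is the open unit disc. $L^2_a(dA_\alpha)$ is the weighted Bergman space of analytic $f$ on $\mathbb{D}$ with $\int_{\mathbb{D}}|f|^2dA_\alpha<\infty$, $dA_{\alpha}(z)=(\alpha+1)(1-|z|^2)^{\alpha}dA(z)$, $dA$ normalized area measure. $C_{\psi,\phi}f=\psi\cdot(f\circ\phi)$. $W(T)=\{\langle Tf,f\rangle:\|f\|=1\}$. *)

(* Defs.v *)
(* Complex numbers are R[i] (mathcomp-real-closed). *)
From HB Require Import structures.
From mathcomp Require Import all_boot all_order all_algebra.
From mathcomp Require Import all_classical all_reals all_analysis.
From mathcomp Require Import complex.
Set Implicit Arguments. Unset Strict Implicit. Unset Printing Implicit Defensive.
Import Order.TTheory GRing.Theory Num.Theory.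
Import numFieldNormedType.Exports.
Local Open Scope ring_scope.
Local Open Scope classical_set_scope.
Local Open Scope complex_scope.

Section BergmanDefs.
Variable R : realType.

(* |z|^2 and |z| as real numbers *)
Definition cabs2 (z : R[i]) : R := complex.Re z ^+ 2 + complex.Im z ^+ 2.
Definition cabs (z : R[i]) : R := Num.sqrt (cabs2 z).

(* e^{i t} *)
Definition expi (t : R) : R[i] := cos t +i* sin t.

(* identification R^2 ~ C, the open unit disc as a subset of R^2 *)
Definition toC (p : R * R) : R[i] := p.1 +i* p.2.
Definition disc2 : set (R * R) := [set p | p.1 ^+ 2 + p.2 ^+ 2 < 1].

(* Lebesgue (area) measure on R^2 *)
Definition area := ((@lebesgue_measure R) \x (@lebesgue_measure R))%E.

(* density of dA_alpha w.r.t. Lebesgue measure on R^2: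
   dA = dx dy / pi (normalized), dA_alpha = (alpha+1)(1-|z|^2)^alpha dA *)
Definition weight (alpha : R) (p : R * R) : R :=
  (alpha + 1) / pi * (1 - (p.1 ^+ 2 + p.2 ^+ 2)) `^ alpha.

(* f is analytic on D with Taylor coefficients a : f(z) = sum_k a_k z^k on D *)
Definition power_series_on_disc (f : R[i] -> R[i]) (a : nat -> R[i]) : Prop :=
  forall z : R[i], cabs z < 1 ->
    (fun N : nat => cabs (\sum_(k < N) a k * z ^+ k - f z)) @ \oo --> (0 : R).

Definition analytic_disc (f : R[i] -> R[i]) : Prop :=
  exists a : nat -> R[i], power_series_on_disc f a.

(* ||f||^2 in L^2(dA_alpha) *)
Definition bergman_norm2 (alpha : R) (f : R[i] -> R[i]) : \bar R :=
  (\int[area]_(p in disc2) (weight alpha p * cabs2 (f (toC p)))%:E)%E.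

(* membership in L^2_a(dA_alpha) *)
Definition in_bergman (alpha : R) (f : R[i] -> R[i]) : Prop :=
  analytic_disc f /\ (bergman_norm2 alpha f < +oo)%E.

(* <g, f> = int_D g conj(f) dA_alpha *)
Definition bergman_inner (alpha : R) (g f : R[i] -> R[i]) : R[i] :=
  (Rintegral area disc2
     (fun p => weight alpha p * complex.Re (g (toC p) * (f (toC p))^*)))
  +i* (Rintegral area disc2
     (fun p => weight alpha p * complex.Im (g (toC p) * (f (toC p))^*))).

(* weighted composition operator C_{psi,phi} f = psi * (f o phi) *)
Definition wcomp (psi phi : R[i] -> R[i]) (f : R[i] -> R[i]) : R[i] -> R[i] :=
  fun z => psi z * f (phi z).

(* T is a bounded operator on L^2_a(dA_alpha) *)
Definition bounded_on_bergman (alpha : R)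
    (T : (R[i] -> R[i]) -> (R[i] -> R[i])) : Prop :=
  exists M : R, forall f, in_bergman alpha f ->
    in_bergman alpha (T f) /\
    (bergman_norm2 alpha (T f) <= M%:E * bergman_norm2 alpha f)%E.

(* numerical range W(T) = { <Tf, f> : ||f|| = 1 } *)
Definition numerical_range (alpha : R)
    (T : (R[i] -> R[i]) -> (R[i] -> R[i])) : set R[i] :=
  [set bergman_inner alpha (T f) f | f in
     [set f | in_bergman alpha f /\ bergman_norm2 alpha f = 1%E]].

(* Euler Gamma function, Gamma(s) = int_0^oo t^{s-1} e^{-t} dt *)
Definition Gamma (s : R) : R :=
  Rintegral (@lebesgue_measure R) `]0, +oo[%classic
    (fun t => t `^ (s - 1) * expR (- t)).

(* closed elliptical region with foci a, b and major axis of length L *)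
Definition closed_ellipse (a b : R[i]) (L : R) : set R[i] :=
  [set z | cabs (z - a) + cabs (z - b) <= L].

(* length of the minor axis of that ellipse *)
Definition ellipse_minor_axis (a b : R[i]) (L : R) : R :=
  Num.sqrt (L ^+ 2 - cabs2 (a - b)).

End BergmanDefs.

(* Main.v *)
(* The compression of the operator to the span of 1 and z^m, m = np + j, is, in
   the orthonormal basis (1, z^m / ||z^m||), a triangular 2 x 2 matrix with
   diagonal entries psihat_0, lambda^m psihat_0 and off-diagonal entry
   ||z^m|| psihat_m; the elliptic range theorem then gives the ellipse.
   The matrix entries come from two facts. The area measure is invariant under
   rotations (each being a product of shears), so distinct monomials are
   orthogonal, and <g, z^l> is the l-th Taylor coefficient of g times ||z^l||^2.
   The image of the area measure under |z|^2 is pi times Lebesgue measure on the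
   half-line, so ||z^l||^2 is a Beta integral. *)
Require Import Defs.
From HB Require Import structures.
From mathcomp Require Import all_boot all_order all_algebra.
From mathcomp Require Import all_classical all_reals all_analysis measurable_realfun.
From mathcomp Require Import complex.
From mathcomp Require Import ring lra.
Import Order.TTheory GRing.Theory Num.Theory.
Import numFieldNormedType.Exports.
Local Open Scope ring_scope.
Local Open Scope classical_set_scope.
Local Open Scope complex_scope.

(** * Complex numbers and the elliptic range *)

(** The matrix is triangular because the image of [z ^+ m] is [lambda ^+ m * z ^+ m * psi], which
    has no Taylor coefficient below [m] and so is orthogonal to 1. The obstacle is that the image of
    a binomial [u + v * z ^+ m] is an arbitrary element of the Bergman space. Its partial sums need
    not be uniformly bounded on the disc, so orthogonality of monomials alone does not yield its
    inner product with a monomial. Sum and integral are therefore exchanged on smaller closed discs,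
    and the radius then tends to 1 by means of the finite norm of the image, which boundedness of
    the operator provides. No angular integral is computed: the rotation by [pi / (k - l)] changes
    the sign of [z ^+ k * conjc (z ^+ l)]. Shears are the convenient generators of rotations because
    a product measure sees them section by section, as translations. Every point of the closed
    region is attained by an explicit unit vector, so no closure argument is involved. *)

Lemma cabs2_ge0 {R : realType} (z : R[i]) : 0 <= cabs2 z.
Proof. by rewrite addr_ge0// sqr_ge0. Qed.

Lemma cabs2_eq0 {R : realType} (z : R[i]) : (cabs2 z == 0) = (z == 0).
Proof. by case: z => x y; rewrite paddr_eq0 ?sqr_ge0// !sqrf_eq0 eq_complex. Qed.

Lemma cabs2M {R : realType} (x y : R[i]) : cabs2 (x * y) = cabs2 x * cabs2 y.
Proof. by case: x y => [a b] [c d]; rewrite /cabs2 /=; ring. Qed.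

Lemma cabs2_conj {R : realType} (z : R[i]) : cabs2 (conjc z) = cabs2 z.
Proof. by case: z => x y; rewrite /cabs2/= sqrrN. Qed.

Lemma mulcJ {R : realType} (z : R[i]) : z * conjc z = (cabs2 z)%:C.
Proof. by case: z => x y; apply/eqP; rewrite eq_complex /cabs2/=; apply/andP; split; apply/eqP; ring. Qed.

Lemma conjCK {R : realType} (z : R[i]) : conjc (conjc z) = z.
Proof. by case: z => x y /=; rewrite opprK. Qed.

Lemma cabs_sqr {R : realType} (z : R[i]) : cabs z ^+ 2 = cabs2 z.
Proof. by rewrite sqr_sqrtr// cabs2_ge0. Qed.

Lemma cabs_normc {R : realType} (z : R[i]) : cabs z = Normc.normc z.
Proof. by case: z. Qed.

Lemma cabs_ge0 {R : realType} (z : R[i]) : 0 <= cabs z.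
Proof. exact: sqrtr_ge0. Qed.

Lemma cabsM {R : realType} (x y : R[i]) : cabs (x * y) = cabs x * cabs y.
Proof. by rewrite !cabs_normc Normc.normcM. Qed.

Lemma cabs1 {R : realType} : cabs (1 : R[i]) = 1.
Proof. by rewrite cabs_normc Normc.normc1. Qed.

Lemma cabs0 {R : realType} : cabs (0 : R[i]) = 0.
Proof. by rewrite cabs_normc Normc.normc0. Qed.

Lemma cabsX {R : realType} (x : R[i]) k : cabs (x ^+ k) = cabs x ^+ k.
Proof. by elim: k => [|k IH]; rewrite ?expr0 ?cabs1// !exprS cabsM IH. Qed.

Lemma cabsC {R : realType} (x : R) : cabs x%:C = `|x|.
Proof. by rewrite /cabs /cabs2/= expr0n addr0 sqrtr_sqr. Qed.

Lemma cabs_conj {R : realType} (z : R[i]) : cabs (conjc z) = cabs z.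
Proof. by rewrite /cabs cabs2_conj. Qed.

Lemma cabs_le_add {R : realType} (x y : R[i]) : cabs (x + y) <= cabs x + cabs y.
Proof. by rewrite !cabs_normc le_normcD. Qed.

Lemma cabs_sum {R : realType} (F : nat -> R[i]) n :
  cabs (\sum_(k < n) F k) <= \sum_(k < n) cabs (F k).
Proof.
elim: n => [|n IH]; first by rewrite !big_ord0 cabs0.
by rewrite !big_ord_recr/= (le_trans (cabs_le_add _ _))// lerD2r.
Qed.

Lemma normr_Re_le {R : realType} (z : R[i]) : `|complex.Re z| <= cabs z.
Proof. by rewrite -sqrtr_sqr ler_sqrt ?cabs2_ge0// lerDl sqr_ge0. Qed.

(** Here [P] and [Q] are the distances to the foci and [L] is the major axis. Both [(P + Q) ^+ 2]
    and [(Q - P) ^+ 2] are at most [L ^+ 2], and the product of the two gaps contains only [P ^+ 2]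
    and [Q ^+ 2]. The conclusion says that the quadratic [(D + r) * t ^+ 2 - 2 * X * t + (S - r)]
    has a real root. *)
Lemma ellipse_discriminant {R : realType} (X S D r P Q L : R) : 0 <= r ->
  0 <= P -> 0 <= Q -> P + Q <= L -> L ^+ 2 = 4 * (D + r) ->
  P ^+ 2 = S + D - 2 * X -> Q ^+ 2 = S + D + 2 * X ->
  (D + r) * (S - r) <= X ^+ 2.
Proof.
move=> r0 P0 Q0 PQL L2 P2 Q2.
have h1 : (P + Q) ^+ 2 <= 4 * (D + r).
  by rewrite -L2 ler_sqr ?nnegrE ?addr_ge0// (le_trans _ PQL)// addr_ge0.
have h2 : (Q - P) ^+ 2 <= 4 * (D + r) by nra.
have : 0 <= (4 * (D + r) - (P + Q) ^+ 2) * (4 * (D + r) - (Q - P) ^+ 2).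
  by apply: mulr_ge0; rewrite subr_ge0.
have -> : (4 * (D + r) - (P + Q) ^+ 2) * (4 * (D + r) - (Q - P) ^+ 2) =
  16 * (D + r) ^+ 2 - 8 * (D + r) * (P ^+ 2 + Q ^+ 2) + (Q ^+ 2 - P ^+ 2) ^+ 2.
  by ring.
rewrite P2 Q2; nra.
Qed.

(* The right-hand sides are the values <Af, f>, f = (u, v) a unit vector, of the
   triangular matrix A = [[a, 0], [d, b]]. With |u|^2 = (1+t)/2 they form, for
   fixed t, a circle of centre (a+b)/2 + t(a-b)/2 and radius |d| sqrt(1-t^2)/2;
   the point z lies on one of them as soon as a real quadratic in t has a root. *)
Lemma elliptic_range {R : realType} (a b d z : R[i]) : d != 0 ->
  cabs (z - a) + cabs (z - b) <= Num.sqrt (cabs2 (a - b) + cabs2 d) ->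
  exists u v : R[i], cabs2 u + cabs2 v = 1 /\
    z = a * (u * conjc u) + b * (v * conjc v) + d * (u * conjc v).
Proof.
move=> d0 hz.
(* Coordinates centred at the midpoint of the foci: [z] lies on the circle of parameter [t] exactly
   when [cabs2 (zeta - t%:C * delta) = r * (1 - t ^+ 2)]. *)
pose zeta := z - (2^-1)%:C * (a + b); pose delta := (2^-1)%:C * (a - b).
pose X := complex.Re (zeta * conjc delta).
pose S := cabs2 zeta; pose D := cabs2 delta; pose r := cabs2 d / 4.
have r0 : 0 < r by rewrite divr_gt0// lt_def cabs2_eq0 d0 cabs2_ge0.
have A0 : 0 < D + r by rewrite ltr_wpDl// cabs2_ge0.
have hX : (D + r) * (S - r) <= X ^+ 2.
  apply: (@ellipse_discriminant _ X S D r _ _ _ (ltW r0) (cabs_ge0 _)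
    (cabs_ge0 _) hz).
  - rewrite sqr_sqrtr; last by apply: addr_ge0; exact: cabs2_ge0.
    rewrite /D /r /delta.
    by case: {+}a {+}b => [a1 a2] [b1 b2]; rewrite /cabs2/=; field.
  - rewrite cabs_sqr /S /D /X /zeta /delta.
    by case: {+}a {+}b {+}z => [a1 a2] [b1 b2] [x y]; rewrite /cabs2/=; field.
  - rewrite cabs_sqr /S /D /X /zeta /delta.
    by case: {+}a {+}b {+}z => [a1 a2] [b1 b2] [x y]; rewrite /cabs2/=; field.
(* The larger root of the circle equation, expanded as a quadratic in [t]; [hX] makes its
   discriminant nonnegative. *)
pose t := (X + Num.sqrt (X ^+ 2 - (D + r) * (S - r))) / (D + r).
have ht : cabs2 (zeta - t%:C * delta) = r * (1 - t ^+ 2).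
  have -> : cabs2 (zeta - t%:C * delta) = S - 2 * t * X + t ^+ 2 * D.
    rewrite /S /X /D; case: {+}zeta {+}delta => [z1 z2] [d1 d2].
    by rewrite /cabs2/=; ring.
  have : (t * (D + r) - X) ^+ 2 = X ^+ 2 - (D + r) * (S - r).
    rewrite /t divfK ?gt_eqF// addrAC subrr add0r sqr_sqrtr ?subr_ge0//.
  have : D + r != 0 by rewrite gt_eqF.
  move=> Dr0 ht; apply: (mulfI Dr0); apply/eqP; rewrite -subr_eq0; apply/eqP.
  transitivity ((t * (D + r) - X) ^+ 2 - (X ^+ 2 - (D + r) * (S - r))).
    by ring.
  by rewrite ht subrr.
have t1 : t ^+ 2 <= 1 by rewrite -subr_ge0 -(pmulr_rge0 _ r0) -ht cabs2_ge0.
(* At [t = -1] the circle degenerates to the focus [b], and [u] must be 0, so the division by [u]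
   used below is impossible. *)
have [tN1|tN1] := eqVneq t (-1).
  exists 0, 1; split; first by rewrite /cabs2/= expr0n expr1n/= !addr0 add0r.
  move/eqP: ht; rewrite tN1 sqrrN expr1n subrr mulr0 cabs2_eq0.
  rewrite /zeta /delta => /eqP h.
  rewrite !mul0r !mulr0 !addr0 mulcJ add0r; apply/eqP.
  rewrite (_ : (cabs2 1)%:C = 1) ?mulr1; last by rewrite /cabs2/= expr1n expr0n addr0.
  rewrite -subr_eq0 -h; apply/eqP.
  by case: {+}a {+}b {+}z => [a1 a2] [b1 b2] [x y]; simpc; congr Complex; field.
have t1' : 0 < 1 + t.
  by rewrite lt_def addrC addr_eq0 tN1/=; move: t1; nra.
(* Choose [u = q] real; then [w = conjc v] is forced by [d * q * w = zeta - t * delta], and the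
   circle equation gives it the right modulus. *)
pose q := Num.sqrt ((1 + t) / 2).
have q2 : q ^+ 2 = (1 + t) / 2 by rewrite sqr_sqrtr// divr_ge0// ltW.
have q0 : q%:C != 0 :> R[i].
  by rewrite eq_complex/= eqxx andbT gt_eqF// sqrtr_gt0 divr_gt0.
pose w := (zeta - t%:C * delta) / (d * q%:C).
have dw : d * q%:C * w = zeta - t%:C * delta.
  by rewrite /w mulrC divfK// mulf_neq0.
have w2 : cabs2 w = (1 - t) / 2.
  have : cabs2 d * q ^+ 2 * cabs2 w = r * (1 - t ^+ 2).
    by rewrite -ht -dw !cabs2M /cabs2/= expr0n addr0.
  rewrite q2 /r => h.
  have dt : cabs2 d * ((1 + t) / 2) != 0.
    by rewrite mulf_neq0 ?cabs2_eq0// mulf_neq0// gt_eqF.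
  apply: (mulfI dt); rewrite h; by field.
pose u : R[i] := q%:C; pose v : R[i] := conjc w.
exists u, v; rewrite {}/u {}/v; split.
  by rewrite cabs2_conj w2 {1}/cabs2/= q2 expr0n/= addr0; field.
rewrite conjCK [conjc w * w]mulrC !mulcJ w2 mulrA dw.
rewrite {1}/cabs2/= expr0n/= addr0 q2 /zeta /delta.
by case: {+}a {+}b {+}z => [a1 a2] [b1 b2] [x y]; simpc; congr Complex; field.
Qed.

(** * Rotation invariance of the area measure *)

Section area_preserving_maps.
Context {R : realType}.
Local Open Scope ereal_scope.
Local Notation leb2 := (@area R : {measure set (measurableTypeR R * measurableTypeR R)%type -> \bar R}).
Local Notation leb := (@lebesgue_measure R).

Lemma lebesgue_measure_translation (t : R) (A : set R) : measurable A ->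
  leb ((fun y => y + t)%R @^-1` A) = leb A.
Proof.
move=> mA.
apply/esym; rewrite -[RHS]/(pushforward leb
  ((fun y => y + t)%R : _ -> measurableTypeR R) A).
apply: lebesgue_measure_unique => //=.
  exact: measurable_funD.
move=> _ mt [[a b]] _ <-.
rewrite /pushforward/= (_ : _ @^-1` _ = `](a - t)%R, (b - t)%R]%classic); last first.
  by apply/seteqP; split => y/=; rewrite !in_itv/= ltrBlDr lerBrDr.
by rewrite !lebesgue_measure_itv/= !lte_fin ltrD2r -!EFinD opprB addrA subrK.
Qed.

Definition area_preserving (T : R * R -> R * R) :=
  measurable_fun setT T /\
  forall A, measurable A -> area (T @^-1` A) = area A.

Lemma area_preserving_comp S T :
  area_preserving S -> area_preserving T -> area_preserving (S \o T).
Proof.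
move=> [mS hS] [mT hT]; split; first exact: measurableT_comp.
move=> A mA; rewrite comp_preimage hT ?hS//.
by rewrite -[X in measurable X]setTI; exact: mS.
Qed.

Lemma area_preserving_rect (T : R * R -> R * R) : measurable_fun setT T ->
  (forall A B, measurable A -> measurable B ->
    area (T @^-1` (A `*` B)) = leb A * leb B) -> area_preserving T.
Proof.
move=> mT h; split => // A mA.
have := @product_measure_unique _ _ _ _ R leb leb (pushforward leb2 (T : _ -> (measurableTypeR R * measurableTypeR R)%type)).
by move=> /(_ mT h A mA)/esym.
Qed.

Lemma area_preserving_swap : area_preserving (fun p => (p.2, p.1)).
Proof.
apply: area_preserving_rect; first exact: measurable_fun_pair.
move=> A B mA mB; rewrite (_ : _ @^-1` _ = B `*` A); last first.
  by apply/seteqP; split => -[x y] /= [].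
by rewrite /area product_measure1E// muleC.
Qed.

(** Over [x] in [A] the vertical section of the preimage of [A x B] is a translate of [B], and over
    any other [x] it is empty. *)
Lemma area_preserving_shear (t : R) :
  area_preserving (fun p => (p.1, p.2 + t * p.1)%R).
Proof.
apply: area_preserving_rect.
  apply: measurable_fun_pair => //; apply: measurable_funD => //.
  exact: measurable_funM.
move=> A B mA mB; rewrite /area /product_measure1.
transitivity (\int[leb]_x ((\1_A x)%:E * leb B)); last first.
  rewrite ge0_integralZr//; last exact/measurable_EFinP/measurable_indicP.
  by rewrite integral_indic// setIT.
apply: eq_integral => x _.
rewrite /= indicE; have [xA|xA] := boolP (x \in A).
  rewrite mul1e -(@lebesgue_measure_translation (t * x)%R B)//; congr (leb _).
  apply/seteqP; split => y; rewrite /xsection/= inE/=; first by case.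
  by split => //; exact: set_mem.
rewrite mul0e (_ : xsection _ _ = set0) ?measure0//.
apply/seteqP; split => y //; rewrite /xsection/= inE/= => -[/mem_set].
by rewrite (negbTE xA).
Qed.

Definition rot (t : R) (p : R * R) : R * R :=
  (cos t * p.1 - sin t * p.2, sin t * p.1 + cos t * p.2)%R.

Lemma rotD s t : rot (s + t)%R = rot s \o rot t.
Proof. by apply/funext => -[x y]; rewrite /rot/= cosD sinD; congr pair; ring. Qed.

(* Off [t = pi] modulo [2 pi], a rotation is a product of three shears with
   parameters [- tan (t/2)], [sin t], [- tan (t/2)]. *)
Lemma area_preserving_rot_half (t : R) : cos t != 0%R ->
  area_preserving (rot (t + t)).
Proof.
move=> c0; pose sw (p : R * R) := (p.2, p.1).
pose shy (a : R) (p : R * R) := (p.1, p.2 + a * p.1)%R.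
(* Conjugation by the swap turns a vertical shear into a horizontal one. Each coordinate of the
   identity holds up to a multiple of [cos t ^+ 2 + sin t ^+ 2 - 1]. *)
have -> : rot (t + t) = (sw \o shy (- (sin t / cos t))%R \o sw) \o
    shy (sin (t + t)) \o (sw \o shy (- (sin t / cos t))%R \o sw).
  have h : (cos t * cos t + sin t * sin t - 1 = 0)%R.
    by rewrite -!expr2 cos2Dsin2 subrr.
  apply/funext => -[x y]; rewrite /rot /sw /shy/= cosD sinD; congr pair;
    apply/eqP; rewrite -subr_eq0; apply/eqP.
    transitivity ((cos t * cos t + sin t * sin t - 1) *
      (x - 2 * (sin t / cos t) * y))%R; last by rewrite h mul0r.
    by field.
  transitivity ((cos t * cos t + sin t * sin t - 1) * y)%R; last by rewrite h mul0r.
  by field.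
by do ?apply: area_preserving_comp;
  [exact: area_preserving_swap|exact: area_preserving_shear|
   exact: area_preserving_swap|exact: area_preserving_shear|
   exact: area_preserving_swap|exact: area_preserving_shear|
   exact: area_preserving_swap].
Qed.

(** When [t / 2] is an excluded angle, the rotation is split into two rotations by [t / 2]. Their
    half angle [t / 4] is admissible, since [cos (t / 4) = 0] would give
    [cos (t / 2) = - sin (t / 4) ^+ 2], which is then nonzero. *)
Lemma area_preserving_rot (t : R) : area_preserving (rot t).
Proof.
have [c0|c0] := eqVneq (cos (t / 2)) 0%R; last first.
  by have := area_preserving_rot_half _ c0; rewrite -splitr.
have c4 : cos (t / 4) != 0%R.
  apply/eqP => c4; have := cos0; move: c0; rewrite (_ : t / 2 = t / 4 + t / 4)%R; last by field.
  rewrite cosD c4 mul0r add0r => /eqP; rewrite oppr_eq0 mulf_eq0 orbb => /eqP s4.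
  by have := cos2Dsin2 (t / 4)%R; rewrite c4 s4 expr0n addr0 => /eqP; rewrite eq_sym oner_eq0.
rewrite (_ : t = (t / 4 + t / 4) + (t / 4 + t / 4))%R; last by field.
rewrite rotD.
by apply: area_preserving_comp; exact: area_preserving_rot_half _ c4.
Qed.

Lemma ge0_integral_area_preserving T (D : set (R * R)) (f : R * R -> \bar R) :
  area_preserving T -> measurable D -> measurable_fun D f ->
  (forall p, D p -> 0 <= f p) ->
  \int[leb2]_(p in T @^-1` D) f (T p) = \int[leb2]_(p in D) f p.
Proof.
move=> [mT hT] mD mf f0.
pose RR : measurableType _ := (measurableTypeR R * measurableTypeR R)%type.
have h : {in D, forall p, 0 <= f p} by move=> p; rewrite inE; exact: f0.
apply: (etrans (esym (@ge0_integral_pushforward _ _ RR RR R T mT leb2 D f mD mf h))).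
by apply: eq_measure_integral => //= A mA _; exact: hT.
Qed.

Lemma integral_area_preserving T (D : set (R * R)) (f : R * R -> \bar R) :
  area_preserving T -> measurable D -> measurable_fun D f ->
  \int[leb2]_(p in T @^-1` D) f (T p) = \int[leb2]_(p in D) f p.
Proof.
move=> hT mD mf; rewrite integralE [RHS]integralE; congr (_ - _).
  rewrite -(ge0_integral_area_preserving T D f^\+)//.
    by apply: eq_integral => x _; rewrite !funeposE.
  exact: measurable_funepos.
rewrite -(ge0_integral_area_preserving T D f^\-)//.
  by apply: eq_integral => x _; rewrite !funenegE.
exact: measurable_funeneg.
Qed.

End area_preserving_maps.

(** * Radial integrals *)

Section calculus.
Context {R : realType}.
Local Notation leb := (@lebesgue_measure R).

(** This lemma and the next three restate the differentiation rules for functions written pointwise,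
    with products in place of scalings. Derivatives of explicit formulas can then be assembled as
    terms and adjusted by [is_derive_eq]. *)
Lemma is_derive_add {f g : R -> R} {x a b : R} :
  is_derive x (1 : R) f a -> is_derive x (1 : R) g b ->
  is_derive x (1 : R) (fun y => f y + g y) (a + b).
Proof. exact: is_deriveD. Qed.

Lemma is_derive_mul {f g : R -> R} {x a b : R} :
  is_derive x (1 : R) f a -> is_derive x (1 : R) g b ->
  is_derive x (1 : R) (fun y => f y * g y) (a * g x + f x * b).
Proof.
move=> df dg; rewrite (_ : _ + _ = f x *: b + g x *: a); first exact: is_deriveM.
by rewrite /GRing.scale/= addrC [g x * a]mulrC.
Qed.

Lemma is_derive_inv {f : R -> R} {x a : R} : f x != 0 ->
  is_derive x (1 : R) f a ->
  is_derive x (1 : R) (fun y => (f y)^-1) (- a / f x ^+ 2).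
Proof.
move=> f0 df; rewrite (_ : _ / _ = - (f x) ^- 2 *: a); first exact: is_deriveV.
by rewrite /GRing.scale/= mulNr mulNr mulrC.
Qed.

Lemma is_derive_comp1 {f g : R -> R} {x a b : R} :
  is_derive (g x) (1 : R) f a -> is_derive x (1 : R) g b ->
  is_derive x (1 : R) (fun y => f (g y)) (a * b).
Proof. exact: is_derive1_comp. Qed.

Lemma is_derive_subsqr (c x : R) :
  is_derive x (1 : R) (fun y => c - y ^+ 2) (- (2 * x)).
Proof.
rewrite (_ : (fun y => _) = (fun y => c + - 1 * (y * y))); last first.
  by apply/funext => y; rewrite mulN1r expr2.
have h := is_derive_add (is_derive_cst c x 1) (is_derive_mul
  (is_derive_cst (- 1 : R) x 1) (is_derive_mul (is_derive_id x 1) (is_derive_id x 1))).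
by apply: (is_derive_eq h); rewrite /=; ring.
Qed.

Lemma integral_is_derive (f F : R -> R) (a b : R) : a < b ->
  {within `[a, b], continuous f} -> {within `[a, b], continuous F} ->
  (forall x, a < x -> x < b -> is_derive x (1 : R) F (f x)) ->
  (\int[leb]_(x in `[a, b]) (f x)%:E = (F b - F a)%R%:E)%E.
Proof.
move=> ab cf cF dF; rewrite EFinB; apply: continuous_FTC2 => //.
  have /(continuous_within_itvP _ ab) [_ Fa Fb] := cF.
  split => // x; rewrite in_itv/= => /andP[ax xb].
  by have [] := dF _ ax xb.
move=> x; rewrite in_itv/= => /andP[ax xb].
by rewrite derive1E; have [_ ->] := dF _ ax xb.
Qed.

(* [F] is an antiderivative of [2 sqrt (r^2 - x^2)] that, unlike the usual one
   with arcsine, is given by a formula which is continuous on the whole line. *)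
Lemma integral_chord_length (r : R) : 0 < r ->
  (\int[leb]_(x in `[(- r)%R, r]) (2 * Num.sqrt (r ^+ 2 - x ^+ 2))%R%:E =
   (pi * r ^+ 2)%R%:E)%E.
Proof.
move=> r0.
pose w (x : R) := Num.sqrt (r ^+ 2 - x ^+ 2).
(* The half-angle formula [arcsin (x / r) = 2 * atan (x / (r + w x))], whose denominator is positive
   everywhere because [w] is 0 outside the interval. *)
pose F (x : R) := x * w x + 2 * r ^+ 2 * atan (x * (r + w x)^-1).
have rw (x : R) : 0 < r + w x by rewrite ltr_pwDl// sqrtr_ge0.
have cw : continuous w.
  move=> x; apply: (@continuous_comp _ _ _ (fun x : R => r ^+ 2 - x ^+ 2) Num.sqrt).
    by apply: cvgB; [exact: cvg_cst|exact: exprn_continuous].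
  exact: sqrt_continuous.
have cF : continuous F.
  move=> x; apply: cvgD.
    by apply: cvgM; [exact: cvg_id|exact: cw].
  apply: cvgM; first exact: cvg_cst.
  apply: (@continuous_comp _ _ _ (fun x : R => x * (r + w x)^-1) atan); last exact: continuous_atan.
  apply: cvgM; first exact: cvg_id.
  apply: cvgV; first by rewrite gt_eqF.
  by apply: cvgD; [exact: cvg_cst|exact: cw].
have dF (x : R) : - r < x -> x < r -> is_derive x (1 : R) F (2 * w x).
  move=> xr1 xr2.
  have s0 : 0 < r ^+ 2 - x ^+ 2 by nra.
  have w0 : 0 < w x by rewrite sqrtr_gt0.
  have w2 : w x ^+ 2 = r ^+ 2 - x ^+ 2 by rewrite sqr_sqrtr// ltW.
  have dw : is_derive x (1 : R) w (- x / w x).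
    have h := @is_derive_comp1 Num.sqrt
      (fun y => r ^+ 2 - y ^+ 2) x _ _ (is_derive1_sqrt s0) (is_derive_subsqr (r ^+ 2) x).
    apply: (is_derive_eq h).
    by rewrite /= -/(w x); field; rewrite gt_eqF.
  have rwx : r + w x != 0 by rewrite gt_eqF.
  have w0' : w x != 0 by rewrite gt_eqF.
  have du : is_derive x (1 : R) (fun x => x * (r + w x)^-1) (r / (w x * (r + w x))).
    have h := is_derive_mul (is_derive_id x 1)
      (@is_derive_inv (fun y => r + w y) x _ rwx (is_derive_add (is_derive_cst r x 1) dw)).
    apply: (is_derive_eq h).
    rewrite /= mul1r add0r; apply/eqP; rewrite -subr_eq0; apply/eqP.
    (* The relation between [w x] and [x] is invisible to [field], so the difference of the two
       sides is exhibited as a multiple of it; the same device is used below. *)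
    transitivity ((w x ^+ 2 - (r ^+ 2 - x ^+ 2)) / (w x * (r + w x) ^+ 2)).
      by field; rewrite rwx w0'.
    by rewrite w2 subrr mul0r.
  have h := is_derive_add (is_derive_mul (is_derive_id x 1) dw)
    (is_derive_mul (is_derive_cst (2 * r ^+ 2) x 1)
      (@is_derive_comp1 atan (fun x => x * (r + w x)^-1) x _ _ (is_derive1_atan (x * (r + w x)^-1)) du)).
  apply: (is_derive_eq h).
  rewrite /= -/(w x) mul1r mul0r add0r.
  have -> : 1 + (x * (r + w x)^-1) ^+ 2 = 2 * r / (r + w x).
    apply/eqP; rewrite -subr_eq0; apply/eqP.
    transitivity ((w x ^+ 2 - (r ^+ 2 - x ^+ 2)) / ((r + w x) ^+ 2)).
      by field; rewrite rwx.
    by rewrite w2 subrr mul0r.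
  apply/eqP; rewrite -subr_eq0; apply/eqP.
  transitivity ((r ^+ 2 - x ^+ 2 - w x ^+ 2) / w x).
    by field; rewrite rwx w0' gt_eqF.
  by rewrite w2 subrr mul0r.
have Nrr : - r < r by rewrite gtrN.
have c2w : {within `[- r, r], continuous (fun x => 2 * w x)}.
  apply: continuous_subspaceT => x.
  by apply: cvgM; [exact: cvg_cst|exact: cw].
rewrite (integral_is_derive _ _ _ _ Nrr c2w (continuous_subspaceT cF) dF).
(* At both ends [w] vanishes, which leaves [2 * r ^+ 2 * (atan 1 - atan (-1))]. *)
rewrite /F /w sqrrN subrr sqrtr0 !mulr0 !add0r addr0 mulNr divff ?gt_eqF//.
by rewrite atanN atan1; congr EFin; field.
Qed.

End calculus.

Section radial_integration.
Context {R : realType}.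
Local Notation leb := (@lebesgue_measure R).
Local Notation RR := (measurableTypeR R * measurableTypeR R)%type.

Definition sqnorm (p : R * R) : R := p.1 ^+ 2 + p.2 ^+ 2.

Lemma measurable_sqnorm : measurable_fun setT sqnorm.
Proof. by apply: measurable_funD; exact: measurable_funX. Qed.

Lemma sqnorm_ge0 p : 0 <= sqnorm p.
Proof. by rewrite addr_ge0// sqr_ge0. Qed.

Lemma measurable_sublevel s : measurable [set p | sqnorm p <= s].
Proof.
rewrite (_ : [set _ | _] = sqnorm @^-1` `]-oo, s]); last first.
  by apply/seteqP; split => p; rewrite /= in_itv.
by rewrite -[X in measurable X]setTI; exact: measurable_sqnorm.
Qed.

(** Cavalieri: the section at [x] is a chord of length [2 * Num.sqrt (s - x ^+ 2)]. As [Num.sqrt] is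
    0 on negative numbers, the formula also covers the [x] outside the disc, and the case of
    negative [s]. *)
Lemma area_sublevel s : (@area R [set p | sqnorm p <= s]%R = (pi * Num.max s 0)%R%:E)%E.
Proof.
have sec (x : R) : leb (xsection [set p | sqnorm p <= s] x) =
    (2 * Num.sqrt (s - x ^+ 2))%:E.
  have [s0|s0] := ltP (s - x ^+ 2) 0.
    rewrite ltr0_sqrtr// mulr0 (_ : xsection _ _ = set0) ?measure0//.
    apply/seteqP; split => y //; rewrite /xsection/= inE/= /sqnorm/= => h.
    have := sqr_ge0 y; lra.
  rewrite (_ : xsection _ _ = `[- Num.sqrt (s - x ^+ 2), Num.sqrt (s - x ^+ 2)]%classic); last first.
    apply/seteqP; split => y; rewrite /xsection/= inE/= /sqnorm/= in_itv/= -ler_norml => h.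
      by rewrite -sqrtr_sqr ler_sqrt//; lra.
    have : `|y| ^+ 2 <= Num.sqrt (s - x ^+ 2) ^+ 2 by rewrite ler_sqr ?nnegrE ?sqrtr_ge0.
    rewrite real_normK ?num_real// sqr_sqrtr//; lra.
  rewrite lebesgue_measure_itv/= lte_fin; case: ifPn => h.
    by rewrite -EFinD opprK mulr_natl mulr2n.
  have := sqrtr_ge0 (s - x ^+ 2); rewrite le_eqVlt => /predU1P[<-|h1].
    by rewrite mulr0.
  by move: h; rewrite gtrN// h1.
rewrite /area /product_measure1.
transitivity (\int[leb]_x (2 * Num.sqrt (s - x ^+ 2))%R%:E)%E.
  by apply: eq_integral => x _; exact: sec.
have [s0|s0] := leP s 0.
  rewrite mulr0 integral0_eq// => x _; rewrite ler0_sqrtr ?mulr0//.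
  have := sqr_ge0 x; lra.
pose r := Num.sqrt s.
have r0 : 0 < r by rewrite sqrtr_gt0.
have r2 : r ^+ 2 = s by rewrite sqr_sqrtr// ltW.
rewrite -r2 -(integral_chord_length _ r0) [RHS]integral_mkcond.
apply: eq_integral => x _; rewrite patchE; case: ifPn => // /negP; rewrite inE/= in_itv/=.
move=> h; rewrite ler0_sqrtr ?mulr0// subr_le0.
have : ~ (`|x| <= r) by rewrite ler_norml.
move=> /negP; rewrite -ltNge => h1.
by rewrite -[leRHS]real_normK ?num_real// ler_sqr ?nnegrE// ltW.
Qed.

(** The image of the area measure has no mass below 0, so it cannot be compared with Lebesgue
    measure on the whole line. Scaled by [pi^-1] and completed by Lebesgue measure on the negative
    half-line, it agrees with Lebesgue measure on all intervals []a, b]], and uniqueness applies. *)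
Lemma area_sqnorm_preimage (A : set R) : measurable A -> (A `<=` `[0, +oo[)%classic ->
  @area R (sqnorm @^-1` A) = (pi%:E * leb A)%E.
Proof.
move=> mA A0.
have pi0 : 0 <= (pi : R)^-1 by rewrite invr_ge0 pi_ge0.
pose c : {nonneg R} := NngNum pi0.
pose msq : measurable_fun setT (sqnorm : RR -> measurableTypeR R) := measurable_sqnorm.
have mN : measurable (`]-oo, 0]%classic : set (measurableTypeR R)) by exact: measurable_itv.
pose m1 : {measure set (measurableTypeR R) -> \bar R} :=
  mscale c (measure_function_pushforward__canonical__measure_function_Measure
    (@area R : {measure set RR -> \bar R}) msq).
pose m : {measure set (measurableTypeR R) -> \bar R} :=
  measure_add m1 (mrestr leb mN).
have mE B : m B = ((pi^-1)%:E * area (sqnorm @^-1` B) + leb (B `&` `]-oo, 0%R]))%E.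
  exact: measure_addE.
have H : leb A = m A.
  apply: lebesgue_measure_unique => // _ [[a b]] _ <-.
  have [ab|ba] := ltP a b; last first.
    by rewrite set_itv_ge ?measure0// -leNgt bnd_simp.
  have aE : @area R (sqnorm @^-1` `]a, b]) = (pi * (Num.max b 0 - Num.max a 0))%:E.
    have -> : sqnorm @^-1` `]a, b] = [set p | sqnorm p <= b] `\` [set p | sqnorm p <= a].
      apply/seteqP; split => p; rewrite /= in_itv/=.
        by move=> /andP[h1 ->]; split => //; apply/negP; rewrite -ltNge.
      by move=> [-> /negP]; rewrite -ltNge => ->.
    have hD := @measureD _ _ _ (@area R : {measure set RR -> \bar R}) _ _
      (measurable_sublevel b) (measurable_sublevel a).
    have bfin : (@area R [set p | (sqnorm p <= b)%R] < +oo)%E.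
      by rewrite area_sublevel ltry.
    apply: (etrans (hD bfin)).
    have -> : [set p | sqnorm p <= b] `&` [set p | sqnorm p <= a] = [set p | sqnorm p <= a].
      apply/seteqP; split => p /=; first by case.
      by move=> h; split => //; rewrite (le_trans h)// ltW.
    have ea := area_sublevel a; have eb := area_sublevel b.
    by rewrite mulrBr EFinB -ea -eb.
  rewrite mE aE -EFinM mulrA mulVf ?gt_eqF ?pi_gt0// mul1r.
  rewrite (_ : _ `&` _ = `]a, Num.min b 0]); last first.
    apply/seteqP; split => x; rewrite /= !in_itv/= le_min.
      by move=> [/andP[-> ->] ->].
    by move=> /and3P[-> -> ->].
  rewrite !lebesgue_measure_itv/= !lte_fin ab.
  have [b0|b0] := leP b 0; have [a0|a0] := leP a 0;
    rewrite ?ab ?a0 -?EFinD ?adde0 ?add0e; try (congr EFin; lra);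
    by case: ltP => ?; rewrite -?EFinD ?adde0; congr EFin; lra.
have A00 : leb (A `&` `]-oo, 0]) = 0%E.
  apply: (@subset_measure0 _ _ _ leb _ [set 0]) => //; first exact: measurableI.
    by move=> x [/A0]; rewrite /= !in_itv/= andbT => x0 x0'; apply/eqP; rewrite eq_le x0 x0'.
  exact: lebesgue_measure_set1.
by rewrite H mE A00 adde0 muleA -EFinM mulfV ?gt_eqF ?pi_gt0// mul1e.
Qed.

(** The substitution [s = |z|^2] takes the place of polar coordinates. *)
Lemma integral_disc_radial (h : R -> \bar R) : measurable_fun setT h ->
  (forall s, (0 <= s)%R -> (s < 1)%R -> (0 <= h s)%E) ->
  (\int[@area R]_(p in @disc2 R) h (sqnorm p) = pi%:E * \int[leb]_(s in `[0%R, 1%R[) h s)%E.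
Proof.
move=> mh h0.
have pi0 : 0 <= (pi : R) by exact: pi_ge0.
pose msq : measurable_fun setT (sqnorm : RR -> measurableTypeR R) := measurable_sqnorm.
have h0' : {in (`[0%R, 1%R[%classic : set R), forall y, (0 <= h y)%E}.
  by move=> y; rewrite inE/= in_itv/= => /andP[]; exact: h0.
have -> : @disc2 R = sqnorm @^-1` `[0%R, 1%R[.
  by apply/seteqP; split => p; rewrite /= in_itv/= sqnorm_ge0.
have mI : measurable (`[0%R, 1%R[%classic : set (measurableTypeR R)) by exact: measurable_itv.
have := @ge0_integral_pushforward _ _ RR (measurableTypeR R) R sqnorm msq (@area R)
  `[0%R, 1%R[%classic h mI (measurable_funTS mh) h0'.
move=> /esym e; apply: (etrans e).
rewrite -(@ge0_integral_mscale _ _ _ leb _ mI (NngNum pi0))//; [|exact: measurable_funTS|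
  by move=> y; rewrite /= in_itv/= => /andP[]; exact: h0].
apply: eq_measure_integral => //= A mA sA.
apply: area_sqnorm_preimage => //; apply: (subset_trans sA).
by apply: subset_itvl.
Qed.

End radial_integration.

(** * Beta and Gamma integrals *)

Section beta_integral.
Context {R : realType}.
Variable alpha : R.
Hypothesis alphaN1 : -1 < alpha.
Local Notation leb := (@lebesgue_measure R).

Fixpoint beta_antiderivative (m : nat) (s : R) : R :=
  if m is m'.+1 then
    (m'.+1%:R * beta_antiderivative m' s - s ^+ m'.+1 * (1 - s) `^ (alpha + 1))
      / (m'.+2%:R + alpha)
  else - ((1 - s) `^ (alpha + 1) / (alpha + 1)).

Let a1 : 0 < alpha + 1. Proof. by rewrite -ltrBlDr sub0r. Qed.
Let am m : 0 < m.+2%:R + alpha.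
Proof. by rewrite -natr1 -addrA addrC ltr_wpDr// addrC. Qed.

Lemma is_derive_powR_onem (c x : R) : x < 1 ->
  is_derive x (1 : R) (fun s => (1 - s) `^ c) (- (c * (1 - x) `^ (c - 1))).
Proof.
move=> x1; have x0 : 0 < 1 - x by rewrite subr_gt0.
have d1 := is_derive_add (is_derive_cst (1 : R) x 1)
  (is_derive_mul (is_derive_cst (-1 : R) x 1) (is_derive_id x 1)).
have h := @is_derive_comp1 R (fun y => y `^ c) (fun s => 1 + -1 * s) x
  (c * (1 - x) `^ (c - 1)) _ _ d1.
have -> : (fun s => (1 - s) `^ c) = (fun s => (1 + -1 * s) `^ c).
  by apply/funext => s; rewrite mulN1r.
have h1 : is_derive (1 + -1 * x) (1 : R) (fun y => y `^ c) (c * (1 - x) `^ (c - 1)).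
  by rewrite mulN1r; exact: is_derive1_powR.
by apply: (is_derive_eq (h h1)); rewrite /=; ring.
Qed.

Lemma is_derive_exprn (m : nat) (x : R) :
  is_derive x (1 : R) (fun s => s ^+ m) (m%:R * x ^+ m.-1).
Proof.
elim: m => [|m IH].
  rewrite mul0r (_ : (fun s => _) = cst 1); first exact: is_derive_cst.
  by apply/funext => s; rewrite expr0.
rewrite (_ : (fun s => _) = (fun s => s * s ^+ m)); last first.
  by apply/funext => s; rewrite exprS.
apply: (is_derive_eq (is_derive_mul (is_derive_id x 1) IH)).
case: m {IH} => [|m]; first by rewrite /= mul0r mulr0 addr0.
by rewrite /= mulrCA -exprS mul1r [in RHS]mulrSr mulrDl mul1r addrC.
Qed.

Lemma is_derive_beta_antiderivative m (x : R) : x < 1 ->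
  is_derive x (1 : R) (beta_antiderivative m) (x ^+ m * (1 - x) `^ alpha).
Proof.
move=> x1; elim: m => [|m IH].
  have h := is_derive_mul (is_derive_cst (- (alpha + 1)^-1) x 1)
    (is_derive_powR_onem (alpha + 1) _ x1).
  rewrite (_ : beta_antiderivative 0 = (fun s => - (alpha + 1)^-1 * (1 - s) `^ (alpha + 1))); last first.
    by apply/funext => s; rewrite /= mulNr mulrC.
  apply: (is_derive_eq h); rewrite /= addrK; field; rewrite gt_eqF//.
have h := is_derive_mul (is_derive_cst ((m.+2%:R + alpha)^-1) x 1)
  (is_derive_add (is_derive_mul (is_derive_cst (m.+1%:R : R) x 1) IH)
    (is_derive_mul (is_derive_cst (-1 : R) x 1)
      (is_derive_mul (is_derive_exprn m.+1 x)
       (is_derive_powR_onem (alpha + 1) _ x1)))).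
rewrite (_ : beta_antiderivative m.+1 = (fun s => (m.+2%:R + alpha)^-1 *
  (m.+1%:R * beta_antiderivative m s + -1 * (s ^+ m.+1 * (1 - s) `^ (alpha + 1))))); last first.
  by apply/funext => s; rewrite mulrC mulN1r.
apply: (is_derive_eq h); rewrite /= addrK.
have -> : (1 - x) `^ (alpha + 1) = (1 - x) * (1 - x) `^ alpha.
  rewrite -[in RHS](addrK 1 alpha) mulr_powRB1//; lra.
rewrite !exprS; have := am m; rewrite -!natr1 => h0; field.
by rewrite gt_eqF//; move: h0; rewrite -!natr1; lra.
Qed.

Lemma continuous_beta_integrand m r : r < 1 ->
  {within `[0, r], continuous (fun s : R => s ^+ m * (1 - s) `^ alpha)}.
Proof.
move=> r1; apply: derivable_within_continuous => x; rewrite in_itv/= => /andP[x0 xr].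
have x1 : x < 1 by rewrite (le_lt_trans xr).
by have [] := is_derive_mul (is_derive_exprn m x) (is_derive_powR_onem alpha _ x1).
Qed.

Lemma cvg_beta_antiderivative m :
  (fun n : nat => beta_antiderivative m (1 - n.+2%:R^-1)) @ \oo --> (0 : R).
Proof.
have h : (fun n : nat => (1 - (1 - n.+2%:R^-1)) `^ (alpha + 1)) @ \oo --> (0 : R).
  have /cvg_at_rightP := powR_cvg0 a1; apply; split.
    by move=> n; rewrite opprB addrC subrK invr_gt0.
  under eq_fun do rewrite opprB addrC subrK.
  have := @cvg_harmonic R; rewrite -cvg_shiftS; exact.
elim: m => [|m IH].
  rewrite /= -[X in _ --> X]oppr0; apply: cvgN.
  by rewrite -[X in _ --> X](mul0r (alpha + 1)^-1); apply: cvgM; [exact: h|exact: cvg_cst].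
rewrite /= -[X in _ --> X](mul0r (m.+2%:R + alpha)^-1).
apply: cvgM; last exact: cvg_cst.
rewrite -[X in _ --> X](subrr (0 : R)); apply: cvgB.
  by rewrite -[X in _ --> X](mulr0 m.+1%:R); apply: cvgM; [exact: cvg_cst|exact: IH].
rewrite -[X in _ --> X](mulr0 ((1 - 0 : R) ^+ m.+1)); apply: cvgM; last exact: h.
apply: (@cvg_comp _ _ _ (fun n : nat => 1 - n.+2%:R^-1 : R) (fun x => x ^+ m.+1)); last exact: exprn_continuous.
apply: cvgB; first exact: cvg_cst.
by have := @cvg_harmonic R; rewrite -cvg_shiftS; exact.
Qed.

(** For negative [alpha] the integrand blows up at 1, so the fundamental theorem is applied on
    segments [[0, r n]] and monotone convergence extends the result to [[0, 1[]. *)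
Lemma integral_beta m :
  (\int[leb]_(s in `[0%R, 1%R[) (s ^+ m * (1 - s) `^ alpha)%R%:E =
   (- beta_antiderivative m 0)%R%:E)%E.
Proof.
(* The offset 2 makes even [r 0] positive, as [integral_is_derive] requires a nondegenerate
   segment. *)
pose r n : R := 1 - n.+2%:R^-1.
have r0 n : 0 < r n by rewrite subr_gt0 invf_lt1// ltr1n.
have r1 n : r n < 1 by rewrite ltrBlDr ltrDl invr_gt0.
pose D n : set R := `[0, r n]%classic.
have DU : \bigcup_n D n = `[0, 1[%classic.
  apply/seteqP; split => [x [n _]|x]; rewrite /D/= !in_itv/= => /andP[x0 x1].
    by rewrite x0 (le_lt_trans x1).
  have [k hk] := ltr_add_invr x1; exists k => //=.
  rewrite in_itv/= x0/= /r lerBrDr (le_trans _ (ltW hk))// lerD2l.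
  by rewrite lef_pV2 ?posrE// ler_nat.
have cD n := continuous_beta_integrand m _ (r1 n).
have h := @ge0_nondecreasing_set_cvg_integral _ (measurableTypeR R) R D
  (fun s => (s ^+ m * (1 - s) `^ alpha)%:E) leb _ _ _ _.
rewrite DU in h.
have e : (fun n => \int[leb]_(s in D n) (s ^+ m * (1 - s) `^ alpha)%:E)%E =
    (fun n => (beta_antiderivative m (r n) - beta_antiderivative m 0)%:E).
  apply/funext => n; apply: (integral_is_derive _ _ _ _ (r0 n) (cD n)).
    apply: derivable_within_continuous => x; rewrite in_itv/= => /andP[_ xr].
    by have [] := is_derive_beta_antiderivative m x (le_lt_trans xr (r1 n)).
  by move=> x _ xr; apply: is_derive_beta_antiderivative; rewrite (lt_trans xr).
have ndD : nondecreasing_seq D.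
  apply/nondecreasing_seqP => n; apply/subsetPset => x; rewrite /D/= !in_itv/=.
  move=> /andP[-> xn]; rewrite (le_trans xn)// lerD2l lerN2 lef_pV2 ?posrE//.
  by rewrite ler_nat.
have mf n : measurable_fun (D n) (fun s => (s ^+ m * (1 - s) `^ alpha)%:E).
  apply/measurable_EFinP; apply: subspace_continuous_measurable_fun.
    exact: measurable_itv.
  exact: cD.
have f0 : forall i x, D i x -> (0 <= (x ^+ m * (1 - x) `^ alpha)%:E)%E.
  move=> i x; rewrite /D/= in_itv/= => /andP[x0 _].
  by rewrite lee_fin mulr_ge0 ?exprn_ge0// powR_ge0.
have mD : forall k, measurable (D k) by move=> k; exact: measurable_itv.
have h1 := h ndD mD mf f0.
have h2 := eq_ind _ (fun F : nat -> \bar R => F @ \oo --> _) h1 _ e.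
rewrite -(cvg_lim (@ereal_hausdorff R) h2); apply/cvg_lim; first exact: ereal_hausdorff.
apply: cvg_EFin; first by apply: nearW.
rewrite -[X in _ --> X]add0r; apply: cvgD; last exact: cvg_cst.
exact: cvg_beta_antiderivative.
Qed.

Lemma beta_antiderivative0S m :
  - beta_antiderivative m.+1 0 =
  m.+1%:R / (m.+2%:R + alpha) * - beta_antiderivative m 0.
Proof. by rewrite /= expr0n/= mul0r subr0 mulrAC mulrN. Qed.

End beta_integral.

Section gamma_function.
Context {R : realType}.
Local Notation leb := (@lebesgue_measure R).

Definition gamma_integrand (s t : R) : R := t `^ (s - 1) * expR (- t).

(** Extended real valued, so that monotone convergence can be used directly; [Gamma] is its [fine]
    part. *)
Definition gamma_integral (s : R) : \bar R :=
  (\int[leb]_(t in `]0%R, +oo[) (gamma_integrand s t)%:E)%E.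

Lemma gamma_integrand_ge0 s t : 0 <= gamma_integrand s t.
Proof. by rewrite mulr_ge0 ?powR_ge0 ?expR_ge0. Qed.

Lemma measurable_gamma_integrand s : measurable_fun setT (gamma_integrand s).
Proof.
apply: measurable_funM; first exact: measurable_powR.
by apply: measurableT_comp => //; exact: measurable_expR.
Qed.

(** Raise [t / (2 * a) <= expR (t / (2 * a))] to the power [a]: half of the exponential decay
    absorbs the power of [t]. This gives both integrability and the vanishing of the boundary term
    at infinity. *)
Lemma powR_expRN_le (a t : R) : 0 < a -> 0 <= t ->
  t `^ a * expR (- t) <= (2 * a) `^ a * expR (- (2^-1 * t)).
Proof.
move=> a0 t0.
have a20 : 0 < 2 * a by rewrite mulr_gt0.
have h : t <= 2 * a * expR (t / (2 * a)).
  rewrite mulrC -ler_pdivrMr// (le_trans _ (expR_ge1Dx _))// lerDr//.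
have h2 : t `^ a <= (2 * a * expR (t / (2 * a))) `^ a.
  by apply: ge0_ler_powR => //; rewrite ?nnegrE ?(ltW a0)// mulr_ge0 ?expR_ge0// ltW.
rewrite (_ : - (2^-1 * t) = 2^-1 * t + - t); last by field.
rewrite expRD mulrA ler_wpM2r ?expR_ge0// (le_trans h2)//.
rewrite powRM ?expR_ge0 ?(ltW a20)// -expRM.
by rewrite (_ : t / (2 * a) * a = 2^-1 * t)//; field; rewrite gt_eqF.
Qed.

Lemma cvg_expRN_half : (fun n : nat => expR (- (2^-1 * n.+1%:R)) : R) @ \oo --> (0 : R).
Proof.
rewrite (_ : (fun n => _) = (fun n : nat => expR (- 2^-1) ^+ n.+1)); last first.
  by apply/funext => n; rewrite -expRM_natr mulNr.
have h : (fun n : nat => expR (- 2^-1) ^+ n : R) @ \oo --> (0 : R).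
  by apply: cvg_expr; rewrite ger0_norm ?expR_ge0// expR_lt1 oppr_lt0.
by rewrite -cvg_shiftS in h.
Qed.

Lemma integral_expRN_half :
  (\int[leb]_(t in `[0%R, +oo[) (expR (- (2^-1 * t)))%:E = 2%:E)%E.
Proof.
pose F (t : R) := - 2 * expR (- 2^-1 * t).
have dF (x : R) : is_derive x (1 : R) F (expR (- 2^-1 * x)).
  have h := is_derive_mul (is_derive_cst (- 2 : R) x 1)
   (@is_derive_comp1 _ expR (fun t => - 2^-1 * t) x _ _ (is_derive_expR _)
     (is_derive_mul (is_derive_cst (- 2^-1 : R) x 1) (is_derive_id x 1))).
  by apply: (is_derive_eq h); rewrite /=; field.
have cf : continuous (fun t : R => expR (- (2^-1 * t))).
  move=> x; apply: (@continuous_comp _ _ _ (fun t : R => - (2^-1 * t)) expR); last exact: continuous_expR.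
  by apply: cvgN; apply: cvgM; [exact: cvg_cst|exact: cvg_id].
rewrite (@ge0_continuous_FTC2y _ _ F 0 0).
- by rewrite /F mulr0 expR0 mulr1 EFinN oppeK add0e.
- by move=> x _; exact: expR_ge0.
- exact: continuous_subspaceT.
- rewrite -[X in _ --> X](mulr0 (- 2)); apply: cvgM; first exact: cvg_cst.
  rewrite (_ : (fun t => _) = (fun t : R => expR (- (2^-1 * t)))); last first.
    by apply/funext => t; rewrite mulNr.
  apply: (@cvg_comp _ _ _ (fun t : R => 2^-1 * t) (fun t => expR (- t)) _ +oo%R).
    by apply: gt0_cvgMry => //; exact: cvg_id.
  exact: cvgr_expR.
- by move=> x _; have [] := dF x.
- apply: cvg_at_right_filter; apply/differentiable_continuous/derivable1_diffP.
  by have [] := dF 0.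
- by move=> x _; rewrite derive1E; have [_ ->] := dF x; rewrite mulNr.
Qed.

(** For [1 < s] the exponent [s - 1] is positive, so one exponential bound dominates the integrand
    on the whole half-line. All arguments [m + alpha + 2] are in this range. *)
Lemma gamma_integral_fin_num s : 1 < s -> gamma_integral s \is a fin_num.
Proof.
move=> s1; have s0 : 0 < s - 1 by rewrite subr_gt0.
have C0 : 0 <= (2 * (s - 1)) `^ (s - 1) by exact: powR_ge0.
rewrite ge0_fin_numE; last by apply: integral_ge0 => t _; rewrite lee_fin gamma_integrand_ge0.
have mh (D : set R) : measurable_fun D (fun t : R => (expR (- (2^-1 * t)))%:E).
  apply/measurable_EFinP/measurable_funTS; apply: measurableT_comp.
    exact: measurable_expR.
  by apply: measurableT_comp => //; exact: measurable_funM.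
apply: (@le_lt_trans _ _ (\int[leb]_(t in `]0%R, +oo[)
    (((2 * (s - 1)) `^ (s - 1))%:E * (expR (- (2^-1 * t)))%:E))%E).
  apply: ge0_le_integral => //.
  - by move=> t _; rewrite lee_fin gamma_integrand_ge0.
  - by apply/measurable_EFinP/measurable_funTS; exact: measurable_gamma_integrand.
  - by apply: emeasurable_funM => //; exact: mh.
  - move=> t; rewrite /= in_itv/= andbT => t0; rewrite -EFinM lee_fin.
    by apply: powR_expRN_le => //; exact: ltW.
rewrite ge0_integralZl_EFin//; last exact: mh.
rewrite lte_mul_pinfty ?lee_fin//.
by rewrite integral_itv_obnd_cbnd// integral_expRN_half ltry.
Qed.

Lemma gamma_integral_gt0 s : 1 < s -> (0 < gamma_integral s)%E.
Proof.
move=> s1.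
apply: (@lt_le_trans _ _ (\int[leb]_(t in `[1%R, 2%R]) (expR (- 2))%:E)%E).
  rewrite integral_cst//= lebesgue_measure_itv/= lte_fin ltr1n -EFinD -EFinM lte_fin.
  by rewrite mulr_gt0 ?expR_gt0// subr_gt0 ltr1n.
apply: (@le_trans _ _ (\int[leb]_(t in `[1%R, 2%R]) (gamma_integrand s t)%:E)%E).
  apply: ge0_le_integral => //.
  - by apply/measurable_EFinP/measurable_funTS; exact: measurable_gamma_integrand.
  - move=> t; rewrite /= in_itv/= => /andP[t1 t2]; rewrite lee_fin.
    rewrite -[leLHS]mul1r ler_pM ?expR_ge0//; last by rewrite ler_expR lerN2.
    by rewrite -[leLHS](powRr0 t) ler_powR// subr_ge0 ltW.
apply: ge0_subset_integral => //.
- by apply/measurable_EFinP/measurable_funTS; exact: measurable_gamma_integrand.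
- by move=> t _; rewrite lee_fin gamma_integrand_ge0.
- move=> t; rewrite /= !in_itv/= andbT => /andP[t1 _]; exact: lt_le_trans t1.
Qed.

Lemma continuous_powR_segment (c b : R) : 0 < c -> 0 < b ->
  {within `[0, b], continuous (fun t : R => t `^ c)}.
Proof.
move=> c0 b0; have cx (x : R) : 0 < x -> {for x, continuous (fun t : R => t `^ c)}.
  move=> x0; apply/differentiable_continuous/derivable1_diffP.
  by have [] := @is_derive1_powR R c x x0.
apply/(continuous_within_itvP _ b0); split.
- by move=> x; rewrite in_itv/= => /andP[x0 _]; exact: cx.
- by rewrite powR0 ?gt_eqF//; exact: powR_cvg0.
- by apply: cvg_at_left_filter; exact: cx.
Qed.

Lemma continuous_gamma_integrand s b : 1 < s -> 0 < b ->
  {within `[0, b], continuous (gamma_integrand s)}.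
Proof.
move=> s1 b0 x; apply: cvgM.
  by apply: continuous_powR_segment => //; rewrite subr_gt0.
apply: (@continuous_subspaceT _ _ `[0, b] (fun t : R => expR (- t))) => t.
by apply: (@continuous_comp _ _ _ -%R expR); [exact: opp_continuous|exact: continuous_expR].
Qed.

(** Integration by parts, read off from the derivative [s * gamma_integrand s - gamma_integrand (s +
    1)] of [gamma_integrand (s + 1)], which vanishes at 0. *)
Lemma gamma_integral_segment s b : 1 < s -> 0 < b ->
  (\int[leb]_(t in `]0%R, b]) (gamma_integrand (s + 1) t)%:E =
   s%:E * \int[leb]_(t in `]0%R, b]) (gamma_integrand s t)%:E -
   (gamma_integrand (s + 1) b)%:E)%E.
Proof.
move=> s1 b0; have s2 : 1 < s + 1 by rewrite ltr_wpDr.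
have c1 := continuous_gamma_integrand _ _ s1 b0.
have c2 := continuous_gamma_integrand _ _ s2 b0.
have i1 := continuous_compact_integrable (@segment_compact R 0 b) c1.
have i2 := continuous_compact_integrable (@segment_compact R 0 b) c2.
rewrite !integral_itv_obnd_cbnd; [|
  by apply/measurable_EFinP/measurable_funTS; exact: measurable_gamma_integrand ..].
have G0 : gamma_integrand (s + 1) 0 = 0.
  by rewrite /gamma_integrand addrK powR0 ?mul0r// gt_eqF// (lt_trans ltr01).
have c12 : {within `[0, b], continuous (fun t => s * gamma_integrand s t - gamma_integrand (s + 1) t)}.
  by move=> x; apply: cvgB; [apply: cvgM; [exact: cvg_cst|exact: c1]|exact: c2].
have dG (x : R) : 0 < x -> x < b -> is_derive x (1 : R) (gamma_integrand (s + 1))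
    (s * gamma_integrand s x - gamma_integrand (s + 1) x).
  move=> x0 _; rewrite /gamma_integrand addrK.
  have dN := is_derive_mul (is_derive_cst (- 1 : R) x 1) (is_derive_id x 1).
  have := is_derive_mul (@is_derive1_powR R s x x0)
    (@is_derive_comp1 _ expR (fun t => - 1 * t) x _ _ (is_derive_expR _) dN).
  rewrite (_ : (fun y => y `^ s * expR (-1 * y)) = (fun t => t `^ s * expR (- t))); last first.
    by apply/funext => y; rewrite mulN1r.
  by move=> h; apply: (is_derive_eq h); rewrite /= mulN1r; ring.
have /esym := integral_is_derive _ _ _ _ b0 c12 c2 dG.
rewrite G0 subr0 => ->.
under [X in (_ = _ - X)%E]eq_integral do rewrite EFinB EFinM.
rewrite integralB//=; last exact: integrableZl.
rewrite integralZl//.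
have aux (A B : \bar R) : A \is a fin_num -> B \is a fin_num ->
    (B = s%:E * A - (s%:E * A - B))%E.
  by move=> /fineK <- /fineK <-; rewrite -EFinM -!EFinB; congr EFin; ring.
by apply: aux; [exact: (integrable_fin_num _ i1)|exact: (integrable_fin_num _ i2)].
Qed.

Lemma gamma_integral_rec s : 1 < s ->
  gamma_integral (s + 1) = (s%:E * gamma_integral s)%E.
Proof.
move=> s1.
pose D n : set R := `]0, n.+1%:R]%classic.
have DU : \bigcup_n D n = `]0, +oo[%classic.
  apply/seteqP; split => [x [n _]|x]; rewrite /D/= !in_itv/= ?andbT; first by case/andP.
  move=> x0; exists (Num.truncn x) => //=; rewrite in_itv/= x0/=.
  by rewrite ltW// truncnS_gt.
have ndD : nondecreasing_seq D.
  apply/nondecreasing_seqP => n; apply/subsetPset => x; rewrite /D/= !in_itv/=.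
  by move=> /andP[-> xn]; rewrite (le_trans xn)// ler_nat.
have mD : forall n, measurable (D n) by move=> n; exact: measurable_itv.
have lim (u : R) : (fun n => \int[leb]_(t in D n) (gamma_integrand u t)%:E)%E @ \oo --> gamma_integral u.
  have mu n : measurable_fun (D n) (EFin \o gamma_integrand u).
    by apply/measurable_EFinP/measurable_funTS; exact: measurable_gamma_integrand.
  have u0 n x : D n x -> (0 <= (gamma_integrand u x)%:E)%E.
    by rewrite lee_fin gamma_integrand_ge0.
  have := @ge0_nondecreasing_set_cvg_integral _ (measurableTypeR R) R D _ leb ndD mD mu u0.
  by rewrite DU.
have lim0 : (fun n : nat => (gamma_integrand (s + 1) n.+1%:R)%:E) @ \oo --> (0 : \bar R).
  apply: cvg_EFin; first exact: nearW.
  have C : (fun n : nat => (2 * s) `^ s * expR (- (2^-1 * n.+1%:R))) @ \oo --> (0 : R).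
    by rewrite -[X in _ --> X](mulr0 ((2 * s) `^ s)); apply: cvgM; [exact: cvg_cst|exact: cvg_expRN_half].
  apply: (squeeze_cvgr _ (@cvg_cst _ _ _ _ _) C); apply: nearW => n.
  rewrite gamma_integrand_ge0/= /gamma_integrand addrK.
  by apply: powR_expRN_le => //; rewrite (lt_trans _ s1).
have h : (fun n => \int[leb]_(t in D n) (gamma_integrand (s + 1) t)%:E)%E @ \oo -->
    (s%:E * gamma_integral s)%E.
  rewrite (_ : (fun n => _) = (fun n => s%:E * \int[leb]_(t in D n) (gamma_integrand s t)%:E -
    (gamma_integrand (s + 1) n.+1%:R)%:E))%E; last first.
    by apply/funext => n; exact: gamma_integral_segment.
  rewrite -[X in _ --> X]sube0; apply: cvgeB => //.
    by rewrite fin_num_adde_defl.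
  by apply: cvgeZl => //; exact: lim.
rewrite -(cvg_lim (@ereal_hausdorff R) (lim (s + 1))).
by rewrite -(cvg_lim (@ereal_hausdorff R) h).
Qed.

Lemma GammaE (s : R) : Gamma s = fine (gamma_integral s).
Proof. by []. Qed.

Lemma Gamma_gt0 (s : R) : 1 < s -> 0 < Gamma s.
Proof.
by move=> s1; rewrite GammaE fine_gt0// gamma_integral_gt0//= ltey_eq gamma_integral_fin_num.
Qed.

Lemma GammaS (s : R) : 1 < s -> Gamma (s + 1) = s * Gamma s.
Proof.
by move=> s1; rewrite !GammaE gamma_integral_rec// fineM ?gamma_integral_fin_num.
Qed.

End gamma_function.

(** * Norms of the monomials *)

Section weighted_moments.
Context {R : realType}.
Variable alpha : R.
Hypothesis alphaN1 : -1 < alpha.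

(* The squared norm of [z ^ m], see [integral_weight_sqnorm]. *)
Definition moment (m : nat) : R :=
  m`!%:R * Gamma (alpha + 2) / Gamma (m%:R + alpha + 2).

Let gt1 (m : nat) : 1 < m%:R + alpha + 2.
Proof.
have -> : m%:R + alpha + 2 = m%:R + (1 + (1 + alpha)) by ring.
by rewrite ltr_wpDl// ltrDl -ltrBlDl sub0r.
Qed.

Lemma moment_gt0 m : 0 < moment m.
Proof.
by rewrite divr_gt0 ?Gamma_gt0// mulr_gt0 ?Gamma_gt0// ?ltr0n ?fact_gt0//;
  have := gt1 0; rewrite add0r.
Qed.

Lemma moment0 : moment 0 = 1.
Proof.
rewrite /moment fact0 mul1r add0r divff// gt_eqF// Gamma_gt0//.
by have := gt1 0; rewrite add0r.
Qed.

Lemma momentS m : moment m.+1 = m.+1%:R / (m.+2%:R + alpha) * moment m.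
Proof.
rewrite /moment factS natrM.
have -> : m.+1%:R + alpha + 2 = (m%:R + alpha + 2) + 1 by rewrite -natr1; ring.
rewrite GammaS//.
have h : Gamma (m%:R + alpha + 2) != 0 by rewrite gt_eqF// Gamma_gt0.
have h2 : m%:R + alpha + 2 != 0 by rewrite gt_eqF// (lt_trans ltr01).
have e : m.+2%:R + alpha = m%:R + alpha + 2 by rewrite -!natr1; ring.
by rewrite e; field; rewrite h h2.
Qed.

(** Both sides are 1 at [m = 0] and gain the factor [m.+1 / (m.+2 + alpha)] at each step; this
    replaces the general formula expressing Beta by Gamma. *)
Lemma moment_beta m : (alpha + 1) * - beta_antiderivative alpha m 0 = moment m.
Proof.
have a1 : alpha + 1 != 0 by rewrite gt_eqF// -ltrBlDr sub0r.
elim: m => [|m IH].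
  by rewrite moment0 /= subr0 powR1 opprK mul1r mulfV.
by rewrite momentS -IH beta_antiderivative0S mulrCA.
Qed.

Lemma weight_ge0 p : 0 <= weight alpha p.
Proof.
by rewrite mulr_ge0 ?powR_ge0// divr_ge0 ?pi_ge0// ltW// -ltrBlDr sub0r.
Qed.

Lemma measurable_weight : measurable_fun setT (weight alpha).
Proof.
apply: measurable_funM => //.
apply: (@measurableT_comp _ _ _ _ _ _ (fun x : R => x `^ alpha)).
  exact: measurable_powR.
by apply: measurable_funB => //; exact: measurable_sqnorm.
Qed.

Lemma integral_weight_sqnorm m :
  (\int[@area R]_(p in @disc2 R) (weight alpha p * sqnorm p ^+ m)%R%:E =
   (moment m)%:E)%E.
Proof.
pose h (s : R) : R := (alpha + 1) / pi * (s ^+ m * (1 - s) `^ alpha).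
have a1 : 0 <= (alpha + 1) / pi.
  by rewrite divr_ge0 ?pi_ge0// ltW// -ltrBlDr sub0r.
transitivity (\int[@area R]_(p in @disc2 R) (h (sqnorm p))%:E)%E.
  by apply: eq_integral => p _; rewrite /weight /h -/(sqnorm p) -mulrA [X in _ * X]mulrC.
have mg : measurable_fun setT (fun s : R => s ^+ m * (1 - s) `^ alpha).
  apply: measurable_funM => //.
  apply: (@measurableT_comp _ _ _ _ _ _ (fun x : R => x `^ alpha)).
    exact: measurable_powR.
  by apply: measurable_funB.
rewrite (integral_disc_radial (fun s => (h s)%:E)); last 2 first.
- by apply/measurable_EFinP; exact: measurable_funM.
- by move=> s s0 s1; rewrite lee_fin mulr_ge0// mulr_ge0 ?exprn_ge0 ?powR_ge0.
under eq_integral do rewrite /h EFinM.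
rewrite ge0_integralZl_EFin//.
(* The [pi] from the radial substitution cancels the one that normalizes area in [weight]. *)
- rewrite integral_beta// muleA -!EFinM; congr EFin.
  by rewrite -moment_beta mulrCA mulfV ?mulr1// gt_eqF// pi_gt0.
- move=> s; rewrite /= in_itv/= => /andP[s0 s1].
  by rewrite lee_fin mulr_ge0 ?exprn_ge0 ?powR_ge0.
- exact/measurable_EFinP/measurable_funTS.
Qed.

End weighted_moments.

(** * Power series on the disc *)

Section complex_measurability.
Context {R : realType}.
Implicit Types (D : set (R * R)) (f g : R * R -> R[i]).

Definition measurableC D f :=
  measurable_fun D (fun p => complex.Re (f p)) /\
  measurable_fun D (fun p => complex.Im (f p)).

Lemma measurableC_cst D (c : R[i]) : measurableC D (fun=> c).
Proof. by split; exact: measurable_cst. Qed.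

Lemma measurableC_add D f g : measurableC D f -> measurableC D g ->
  measurableC D (fun p => f p + g p).
Proof.
move=> [f1 f2] [g1 g2]; split.
  rewrite (_ : (fun p => _) = (fun p => complex.Re (f p) + complex.Re (g p))).
    exact: measurable_funD.
  by apply/funext => p; case: (f p) (g p) => [? ?] [].
rewrite (_ : (fun p => _) = (fun p => complex.Im (f p) + complex.Im (g p))).
  exact: measurable_funD.
by apply/funext => p; case: (f p) (g p) => [? ?] [].
Qed.

Lemma measurableC_mul D f g : measurableC D f -> measurableC D g ->
  measurableC D (fun p => f p * g p).
Proof.
move=> [f1 f2] [g1 g2]; split.
  rewrite (_ : (fun p => _) = (fun p => complex.Re (f p) * complex.Re (g p) -
      complex.Im (f p) * complex.Im (g p))).
    by apply: measurable_funB; exact: measurable_funM.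
  by apply/funext => p; case: (f p) (g p) => [? ?] [].
rewrite (_ : (fun p => _) = (fun p => complex.Re (f p) * complex.Im (g p) +
    complex.Im (f p) * complex.Re (g p))).
  by apply: measurable_funD; exact: measurable_funM.
by apply/funext => p; case: (f p) (g p) => [? ?] [].
Qed.

Lemma measurableC_conj D f : measurableC D f -> measurableC D (fun p => conjc (f p)).
Proof.
move=> [f1 f2]; split.
  by rewrite (_ : (fun p => _) = (fun p => complex.Re (f p)))//; apply/funext => p; case: (f p).
rewrite (_ : (fun p => _) = (fun p => - complex.Im (f p))).
  exact: measurable_funN.
by apply/funext => p; case: (f p).
Qed.

Lemma measurableC_exp D f k : measurableC D f -> measurableC D (fun p => f p ^+ k).
Proof.
move=> mf; elim: k => [|k IH].
  by under eq_fun do rewrite expr0; exact: measurableC_cst.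
by under eq_fun do rewrite exprS; exact: measurableC_mul.
Qed.

Lemma measurableC_toC D : measurableC D (@toC R).
Proof.
split; apply: measurable_funTS; [exact: measurable_fst|exact: measurable_snd].
Qed.

Lemma measurableC_psum D (a : nat -> R[i]) N :
  measurableC D (fun p => \sum_(k < N) a k * toC p ^+ k).
Proof.
elim: N => [|N IH].
  by under eq_fun do rewrite big_ord0; exact: measurableC_cst.
under eq_fun do rewrite big_ord_recr.
apply: measurableC_add => //; apply: measurableC_mul; first exact: measurableC_cst.
by apply: measurableC_exp; exact: measurableC_toC.
Qed.

Lemma measurableC_cabs2 D f : measurableC D f -> measurable_fun D (fun p => cabs2 (f p)).
Proof. by move=> [f1 f2]; apply: measurable_funD; exact: measurable_funX. Qed.

End complex_measurability.

Section complex_exponential.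
Context {R : realType}.

Lemma expiD (s t : R) : expi (s + t) = expi s * expi t.
Proof. by rewrite /expi cosD sinD; simpc; congr Complex; ring. Qed.

Lemma expiX (t : R) k : expi t ^+ k = expi (k%:R * t).
Proof.
elim: k => [|k IH]; first by rewrite expr0 mul0r /expi cos0 sin0.
by rewrite exprS IH -expiD -{1}[t]mul1r -mulrDl addrC natr1.
Qed.

Lemma expiN (t : R) : expi (- t) = conjc (expi t).
Proof. by rewrite /expi cosN sinN. Qed.

Lemma cabs2_expi (t : R) : cabs2 (expi t) = 1.
Proof. by rewrite /cabs2/= cos2Dsin2. Qed.

Lemma toC_rot (t : R) p : toC (rot t p) = expi t * toC p.
Proof. by case: p => x y; rewrite /toC /rot /expi/=; simpc; congr Complex; ring. Qed.

Lemma cabs2_toC (p : R * R) : cabs2 (toC p) = sqnorm p.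
Proof. by []. Qed.

Lemma sqnorm_rot (t : R) p : sqnorm (rot t p) = sqnorm p.
Proof. by rewrite -!cabs2_toC toC_rot cabs2M cabs2_expi mul1r. Qed.

Lemma expi_pi : expi (pi : R) = -1.
Proof. by rewrite /expi cospi sinpi; simpc. Qed.

End complex_exponential.

Section power_series.
Context {R : realType}.
Implicit Types (g : R[i] -> R[i]) (a : nat -> R[i]).

(** Convergence at a point [s] between [r] and 1 bounds the terms [cabs (a k) * s ^+ k], so for
    [cabs z <= r] the series is dominated by a geometric one of ratio [r / s]. *)
Lemma psum_bounded g a (r : R) : power_series_on_disc g a -> 0 <= r -> r < 1 ->
  exists2 M, 0 <= M & forall N z, cabs z <= r -> cabs (\sum_(k < N) a k * z ^+ k) <= M.
Proof.
move=> ga r0 r1; pose s := (1 + r) / 2.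
have rs : r < s by rewrite /s; lra.
have s0 : 0 < s by rewrite (le_lt_trans r0).
have s1 : s < 1 by rewrite /s; lra.
have cs : cabs s%:C = s by rewrite cabsC ger0_norm// ltW.
have := ga s%:C; rewrite cs => /(_ s1) h.
have [M0 M0P] : exists M0, forall n, cabs (\sum_(k < n) a k * s%:C ^+ k - g s%:C) <= M0.
  have /cvg_seq_bounded/pinfty_ex_gt0[M M_gt0 hM] : cvg ((fun n => cabs (\sum_(k < n) a k * s%:C ^+ k - g s%:C)) @ \oo).
    by apply/cvg_ex; exists 0.
  by exists M => n; rewrite -[leLHS]ger0_norm ?cabs_ge0//; exact: (hM n I).
have M00 : 0 <= M0 by rewrite (le_trans _ (M0P 0%N))// cabs_ge0.
have term n : cabs (a n) * s ^+ n <= 2 * M0.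
  rewrite -[in leLHS]cs -cabsX -cabsM.
  have -> : a n * s%:C ^+ n = (\sum_(k < n.+1) a k * s%:C ^+ k - g s%:C) +
     -1 * (\sum_(k < n) a k * s%:C ^+ k - g s%:C).
    by rewrite big_ord_recr/=; ring.
  rewrite (le_trans (cabs_le_add _ _))// cabsM.
  have -> : cabs (-1 : R[i]) = 1.
    by rewrite (_ : -1 = (-1 : R)%:C) ?cabsC ?normrN1//; simpc.
  by rewrite mul1r mulr_natl mulr2n lerD.
pose q := r / s.
have q0 : 0 <= q by rewrite divr_ge0// ltW.
have q1 : q < 1 by rewrite ltr_pdivrMr// mul1r.
exists (2 * M0 / (1 - q)).
  by rewrite divr_ge0// ?mulr_ge0// subr_ge0 ltW.
move=> N z zr; apply: le_trans (cabs_sum (fun k => a k * z ^+ k) N) _.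
apply: (@le_trans _ _ (\sum_(k < N) 2 * M0 * q ^+ k)).
  apply: ler_sum => k _; rewrite cabsM cabsX.
  apply: (@le_trans _ _ (cabs (a k) * r ^+ k)).
    by rewrite ler_wpM2l ?cabs_ge0// lerXn2r// nnegrE cabs_ge0.
  rewrite (_ : r = s * q); last by rewrite /q mulrC divfK// gt_eqF.
  by rewrite exprMn mulrA ler_wpM2r ?exprn_ge0// term.
rewrite -mulr_sumr ler_wpM2l ?mulr_ge0//.
rewrite -[leLHS](mulfK (_ : 1 - q != 0)) ?subr_eq0 ?gt_eqF// ler_pdivrMr ?invr_gt0 ?subr_gt0//.
rewrite mulVf ?subr_eq0 ?gt_eqF// mulrC -opprB mulNr -subrX1 opprB lerBlDr lerDl.
by rewrite exprn_ge0.
Qed.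

Lemma psum_Re_cvg g a (c z : R[i]) : power_series_on_disc g a -> cabs z < 1 ->
  (fun N => complex.Re ((\sum_(k < N) a k * z ^+ k) * c)) @ \oo --> complex.Re (g z * c).
Proof.
move=> ga z1; have h := ga _ z1.
have h2 : (fun N => cabs (\sum_(k < N) a k * z ^+ k - g z) * cabs c) @ \oo --> (0 : R).
  by rewrite -[X in _ --> X](mul0r (cabs c)); apply: cvgM; [exact: h|exact: cvg_cst].
apply/cvgrPdist_le => e e0; have /cvgrPdist_le/(_ e e0) := h2.
apply: filterS => N; rewrite sub0r normrN ger0_norm ?mulr_ge0 ?cabs_ge0//.
apply: le_trans; rewrite distrC -cabsM.
rewrite (_ : _ - _ = complex.Re ((\sum_(k < N) a k * z ^+ k - g z) * c)).
  exact: normr_Re_le.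
by rewrite mulrBl; case: (_ * c) (g z * c) => [? ?] [].
Qed.

Lemma power_series_scale g a (c : R[i]) : power_series_on_disc g a ->
  power_series_on_disc (fun z => c * g z) (fun k => c * a k).
Proof.
move=> ga z z1; rewrite -[X in _ --> X](mulr0 (cabs c)).
rewrite (_ : (fun n => _) = (fun N => cabs c * cabs (\sum_(k < N) a k * z ^+ k - g z))); last first.
  apply/funext => N; rewrite -cabsM mulrBr mulr_sumr; congr (cabs (_ - _)).
  by apply: eq_bigr => k _; rewrite mulrA.
by apply: cvgM; [exact: cvg_cst|exact: ga].
Qed.

Lemma power_series_add f g a b : power_series_on_disc f a -> power_series_on_disc g b ->
  power_series_on_disc (fun z => f z + g z) (fun k => a k + b k).
Proof.
move=> fa gb z z1.
have h : (fun N => cabs (\sum_(k < N) a k * z ^+ k - f z) + cabs (\sum_(k < N) b k * z ^+ k - g z)) @ \oo --> (0 : R).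
  by rewrite -[X in _ --> X](addr0 0); apply: cvgD; [exact: fa|exact: gb].
apply: (squeeze_cvgr _ (@cvg_cst _ _ _ _ _) h); apply: nearW => N.
rewrite cabs_ge0/= (_ : _ - _ = (\sum_(k < N) a k * z ^+ k - f z) + (\sum_(k < N) b k * z ^+ k - g z)).
  exact: cabs_le_add.
under eq_bigr do rewrite mulrDl.
by rewrite big_split/=; ring.
Qed.

Lemma power_series_mulX g a m : power_series_on_disc g a ->
  power_series_on_disc (fun z => z ^+ m * g z)
    (fun k => if (k < m)%N then 0 else a (k - m)%N).
Proof.
move=> ga z z1; rewrite -(cvg_shiftn m).
have h : (fun N => cabs (z ^+ m) * cabs (\sum_(k < N) a k * z ^+ k - g z)) @ \oo --> (0 : R).
  by rewrite -[X in _ --> X](mulr0 (cabs (z ^+ m))); apply: cvgM; [exact: cvg_cst|exact: ga].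
rewrite (_ : (fun n => _) = (fun N => cabs (z ^+ m) * cabs (\sum_(k < N) a k * z ^+ k - g z)))//.
apply/funext => N; rewrite -cabsM; congr cabs.
rewrite addnC big_split_ord/= big1 ?add0r => [|k _]; last by rewrite ltn_ord mul0r.
rewrite mulrBr mulr_sumr; congr (_ - _); apply: eq_bigr => k _.
by rewrite ltnNge leq_addr/= addKn exprD mulrCA.
Qed.

Lemma power_series_cst (c : R[i]) :
  power_series_on_disc (fun=> c) (fun k => if k == 0%N then c else 0).
Proof.
move=> z z1; rewrite -cvg_shiftS.
rewrite (_ : (fun n => _) = (fun=> 0)); first exact: cvg_cst.
apply/funext => N; rewrite big_ord_recl/= expr0 mulr1 big1 ?addr0 ?subrr ?cabs0//.
by move=> k _; rewrite mul0r.
Qed.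

Lemma power_series_ext g a b : a =1 b -> power_series_on_disc g a -> power_series_on_disc g b.
Proof. by move=> /funext ->. Qed.

End power_series.

(** * Orthogonality of monomials *)

Section orthogonality.
Context {R : realType}.
Variable alpha : R.
Hypothesis alphaN1 : -1 < alpha.
Local Notation RR := (measurableTypeR R * measurableTypeR R)%type.
Local Notation mu := (@area R : {measure set RR -> \bar R}).
Local Notation w := (@weight R alpha).
Local Notation D1 := (@disc2 R).

(** Only real parts are integrated: an imaginary part is the real part after multiplication by [-i],
    written [0 -i* 1]. *)
Definition wRe (h : R[i] -> R[i]) (p : R * R) : R := w p * complex.Re (h (toC p)).

Definition subdisc (s : R) : set (R * R) := [set p | sqnorm p <= s].

Lemma measurable_disc2 : measurable D1.
Proof.
rewrite (_ : D1 = sqnorm @^-1` `]-oo, 1[); last first.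
  by apply/seteqP; split => p; rewrite /= in_itv.
by rewrite -[X in measurable X]setTI; exact: measurable_sqnorm.
Qed.

Lemma subdisc_sub s : s < 1 -> subdisc s `<=` D1.
Proof. by move=> s1 p ps; exact: le_lt_trans ps s1. Qed.

Lemma cabs_toC_lt1 p : D1 p -> cabs (toC p) < 1.
Proof.
by move=> p1; rewrite -sqrtr1 ltr_sqrt.
Qed.

Lemma weight_rot t p : w (rot t p) = w p.
Proof. by rewrite /weight -!/(sqnorm _) sqnorm_rot. Qed.

Lemma integrable_weight : mu.-integrable D1 (EFin \o w).
Proof.
apply/integrableP; split.
  by apply/measurable_EFinP/measurable_funTS; exact: measurable_weight.
rewrite (_ : (\int[_]_(x in _) _)%E = (moment alpha 0)%:E) ?ltry//.
rewrite -integral_weight_sqnorm//; apply: eq_integral => p _.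
by rewrite /= expr0 mulr1 ger0_norm// weight_ge0.
Qed.

Lemma integrable_weight_le (D : set (R * R)) (f : R * R -> R) (M : R) :
  measurable D -> D `<=` D1 -> measurable_fun D f ->
  (forall p, D p -> `|f p| <= M) -> mu.-integrable D (EFin \o (fun p => w p * f p)).
Proof.
move=> mD DD1 mf fM.
apply: (@le_integrable _ RR _ mu D mD _ (fun p => (M%:E * (w p)%:E)%E)).
- apply/measurable_EFinP; apply: measurable_funM => //.
  by apply: measurable_funTS; exact: measurable_weight.
- move=> p Dp; rewrite -EFinM !abse_EFin lee_fin !normrM mulrC ler_wpM2r//.
  by rewrite (le_trans (fM p Dp))// ler_norm.
- apply: integrableZl => //.
  exact: (@integrableS _ RR R mu D1 D _ measurable_disc2 mD DD1 integrable_weight).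
Qed.

Lemma normr_Re_monomial_le (a z : R[i]) k l : cabs z <= 1 ->
  `|complex.Re (a * z ^+ k * conjc (z ^+ l))| <= cabs a.
Proof.
move=> z1; apply: le_trans (normr_Re_le _) _.
rewrite cabsM cabs_conj cabsM [cabs (_ ^+ k)]cabsX [cabs (_ ^+ l)]cabsX.
rewrite -mulrA -exprD; apply: ler_piMr; first exact: cabs_ge0.
by apply: exprn_ile1 => //; exact: cabs_ge0.
Qed.

(** The rotation by [t = pi / (k - l)] preserves the disc, the area and the weight, and multiplies
    the integrand by [cos pi = -1]; the integral is its own opposite. *)
Lemma integral_monomial_eq0 s (a : R[i]) k l : k <> l -> s < 1 ->
  (\int[mu]_(p in subdisc s) (wRe (fun z => a * z ^+ k * conjc (z ^+ l)) p)%:E = 0)%E.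
Proof.
move=> kl s1; set f := wRe _.
have kl0 : k%:R - l%:R != 0 :> R by rewrite subr_eq0 eqr_nat; exact/eqP.
pose t : R := pi / (k%:R - l%:R).
have ft p : f (rot t p) = - f p.
  rewrite /f /wRe weight_rot toC_rot -mulrN; congr (_ * _).
  rewrite !exprMn rmorphM/= !expiX -expiN.
  have -> : a * (expi (k%:R * t) * toC p ^+ k) * (expi (- (l%:R * t)) * conjc (toC p ^+ l)) =
     expi (k%:R * t) * expi (- (l%:R * t)) * (a * toC p ^+ k * conjc (toC p ^+ l)) by ring.
  rewrite -expiD (_ : k%:R * t + _ = pi); last first.
    by rewrite -mulNr -mulrDl /t mulrC divfK.
  by rewrite expi_pi mulN1r; case: (a * _ * _).
have mr : measurable_fun setT
    (fun p => complex.Re (a * toC p ^+ k * conjc (toC p ^+ l))).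
  have [] // := @measurableC_mul R setT (fun p => a * toC p ^+ k) (fun p => conjc (toC p ^+ l)).
    by apply: measurableC_mul; [exact: measurableC_cst|apply: measurableC_exp; exact: measurableC_toC].
  by apply: measurableC_conj; apply: measurableC_exp; exact: measurableC_toC.
have mf D : measurable_fun D (EFin \o f).
  apply/measurable_EFinP/measurable_funTS; apply: measurable_funM => //.
  exact: measurable_weight.
have h := integral_area_preserving (rot t) (subdisc s) (EFin \o f) (area_preserving_rot t)
  (measurable_sublevel s) (mf _).
have e : rot t @^-1` subdisc s = subdisc s.
  by apply/seteqP; split => p; rewrite /subdisc/= sqnorm_rot.
rewrite e in h.
have fi : mu.-integrable (subdisc s) (EFin \o f).
  apply: (integrable_weight_le (subdisc s)
    (fun p => complex.Re (a * toC p ^+ k * conjc (toC p ^+ l))) (cabs a)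
    (measurable_sublevel s) (subdisc_sub s s1) (measurable_funTS mr)).
  move=> p ps; apply: normr_Re_monomial_le; apply: ltW.
  exact: (cabs_toC_lt1 _ (subdisc_sub s s1 p ps)).
have hN : (- (\int[mu]_(p in subdisc s) (f p)%:E) = \int[mu]_(p in subdisc s) (f p)%:E)%E.
  rewrite -[RHS]h -[LHS]mulN1e.
  apply: (etrans (esym (@integralZl _ RR R mu _ (measurable_sublevel s) _ fi (- 1)))).
  by apply: eq_integral => p _; rewrite /= ft -EFinM mulN1r.
have aux (J : \bar R) : J \is a fin_num -> (- J = J)%E -> J = 0%E.
  move=> /fineK <-; rewrite -EFinN => -[] /eqP.
  by rewrite eq_sym -subr_eq0 opprK -mulr2n mulrn_eq0/= => /eqP ->.
apply: (aux _ _ hN).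
exact: (@integrable_fin_num _ RR R mu _ (measurable_sublevel s) _ fi).
Qed.

(* Termwise integration is legitimate on a smaller disc, where the partial sums
   are uniformly bounded. *)
Lemma integral_subdisc_eq0 s g a l : power_series_on_disc g a -> a l = 0 -> s < 1 ->
  (\int[mu]_(p in subdisc s) (wRe (fun z => g z * conjc (z ^+ l)) p)%:E = 0)%E.
Proof.
move=> ga al0 s1.
have [s0|s0] := ltP s 0.
  rewrite (_ : subdisc s = set0) ?integral_set0//.
  apply/seteqP; split => p //; rewrite /subdisc/= => h.
  by have := sqnorm_ge0 p; rewrite leNgt (le_lt_trans h).
pose r := Num.sqrt s.
have r1 : r < 1 by rewrite -sqrtr1 ltr_sqrt.
have [M M0 hM] := psum_bounded g a r ga (sqrtr_ge0 _) r1.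
have pr p : subdisc s p -> cabs (toC p) <= r.
  by move=> ps; rewrite ler_sqrt.
pose S N z := \sum_(k < N) a k * z ^+ k : R[i].
have mD : measurable (subdisc s) by exact: measurable_sublevel.
have DD := subdisc_sub s s1.
have mc : measurableC (subdisc s) (fun p : R * R => conjc (toC p ^+ l)).
  by apply: measurableC_conj; apply: measurableC_exp; exact: measurableC_toC.
have mS N : measurable_fun (subdisc s) (fun p => complex.Re (S N (toC p) * conjc (toC p ^+ l))).
  by have [] := measurableC_mul _ _ _ (measurableC_psum (subdisc s) a N) mc.
have bS N p : subdisc s p -> `|complex.Re (S N (toC p) * conjc (toC p ^+ l))| <= M.
  move=> ps; rewrite (le_trans (normr_Re_le _))// cabsM cabs_conj cabsX.
  rewrite -[leRHS]mulr1 ler_pM ?cabs_ge0 ?exprn_ge0 ?cabs_ge0//; first by apply: hM; exact: pr.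
  by rewrite exprn_ile1 ?cabs_ge0// ltW// cabs_toC_lt1//; exact: DD.
have iS N : mu.-integrable (subdisc s) (EFin \o wRe (fun z => S N z * conjc (z ^+ l))).
  exact: (integrable_weight_le _ _ M mD DD (mS N) (bS N)).
(* Each new term integrates to 0: by orthogonality if [N <> l], and because [a l = 0] if [N = l]. *)
have S0 N : (\int[mu]_(p in subdisc s) (wRe (fun z => S N z * conjc (z ^+ l))%R p)%:E = 0)%E.
  elim: N => [|N IH].
    rewrite integral0_eq// => p _; rewrite /wRe /S big_ord0 mul0r/= mulr0//.
  have eS p : wRe (fun z => S N.+1 z * conjc (z ^+ l)) p =
     wRe (fun z => S N z * conjc (z ^+ l)) p + wRe (fun z => a N * z ^+ N * conjc (z ^+ l)) p.
    rewrite /wRe /S big_ord_recr/= mulrDl -mulrDr; congr (_ * _).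
    by case: (_ * _) (_ * _) => [? ?] [].
  have i1 : mu.-integrable (subdisc s) (EFin \o wRe (fun z => a N * z ^+ N * conjc (z ^+ l))).
    pose u k := wRe (fun z => S k z * conjc (z ^+ l)).
    rewrite (_ : _ \o _ = (EFin \o u N.+1) \- (EFin \o u N))%E.
      exact: (@integrableB _ RR R mu _ mD _ _ (iS N.+1) (iS N)).
    by apply/funext => p; rewrite /= /u eS -EFinB addrAC subrr add0r.
  under eq_integral do rewrite eS EFinD.
  rewrite (@integralD _ RR _ mu _ mD _ _ (iS N) i1) IH add0e.
  have [Nl|/eqP Nl] := eqVneq N l; last exact: integral_monomial_eq0.
  rewrite integral0_eq// => p _.
  transitivity (w p * complex.Re (a N * toC p ^+ N * conjc (toC p ^+ l)))%:E => //.
  by rewrite Nl al0 !mul0r/= mulr0.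
pose fS N p : \bar R := (wRe (fun z => S N z * conjc (z ^+ l)) p)%:E.
pose fg p : \bar R := (wRe (fun z => g z * conjc (z ^+ l)) p)%:E.
pose G p : \bar R := (M%:E * (w p)%:E)%E.
have h1 N : measurable_fun (subdisc s) (fS N) by exact: (@measurable_int _ RR R mu _ _ (iS N)).
have h2 p : subdisc s p -> fS ^~ p @ \oo --> fg p.
  move=> ps; apply: cvg_EFin; first exact: nearW.
  apply: cvgM; first exact: cvg_cst.
  by apply: psum_Re_cvg => //; apply: cabs_toC_lt1; exact: DD.
have h3 p : subdisc s p -> G p \is a fin_num by [].
have h4 : mu.-integrable (subdisc s) G.
  apply: (@integrableZl _ RR R mu _ mD).
  exact: (@integrableS _ RR R mu D1 _ _ measurable_disc2 mD DD integrable_weight).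
have h5 N p : subdisc s p -> (`|fS N p| <= G p)%E.
  move=> ps; rewrite /G -EFinM abse_EFin lee_fin normrM mulrC ler_pM//; first exact: bS.
  by rewrite ger0_norm// weight_ge0.
have cv := @dominated_cvg _ RR R mu (subdisc s) mD fS fg G h1 h2 h3 h4 h5.
have E : (fun N => \int[mu]_(p in subdisc s) fS N p)%E = (fun=> 0%E).
  by apply/funext => N; exact: S0.
have c0 := eq_ind _ (fun F : nat -> \bar R => F @ \oo --> _) cv _ E.
by rewrite -(cvg_lim (@ereal_hausdorff R) c0); apply/cvg_lim; [exact: ereal_hausdorff|exact: cvg_cst].
Qed.


End orthogonality.

(** * Inner products with binomials *)

Section bergman_inner_products.
Context {R : realType}.
Variable alpha : R.
Hypothesis alphaN1 : -1 < alpha.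
Local Notation RR := (measurableTypeR R * measurableTypeR R)%type.
Local Notation mu := (@area R : {measure set RR -> \bar R}).
Local Notation w := (@weight R alpha).
Local Notation D1 := (@disc2 R).

Lemma wReD h1 h2 p : wRe alpha (fun z => h1 z + h2 z) p = wRe alpha h1 p + wRe alpha h2 p.
Proof.
rewrite /wRe -mulrDr; congr (_ * _).
by case: (h1 _) (h2 _) => [? ?] [].
Qed.

(** The restrictions of [f] to the discs of squared radius [1 - n.+1%:R^-1] converge pointwise and
    are dominated by the absolute value of [f], so integrability on the disc replaces the missing
    uniform bound. *)
Lemma integral_disc_exhaustion (f : R * R -> R) : mu.-integrable D1 (EFin \o f) ->
  (forall s : R, (s < 1)%R -> \int[mu]_(p in subdisc s) (f p)%:E = 0)%E ->
  (\int[mu]_(p in D1) (f p)%:E = 0)%E.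
Proof.
move=> fi f0; pose r n : R := 1 - n.+1%:R^-1.
have r1 n : r n < 1 by rewrite ltrBlDr ltrDl invr_gt0.
pose F n p : \bar R := ((EFin \o f) \_ (subdisc (r n))) p.
have mf := @measurable_int _ RR R mu _ _ fi.
have h1 n : measurable_fun D1 (F n).
  apply: (@measurable_restrict _ _ RR _ (subdisc (r n)) D1 (EFin \o f)
    (measurable_sublevel (r n)) measurable_disc2).1.
  exact: (@measurable_funS _ _ RR _ D1 _ _ measurable_disc2 (@subIsetl _ _ _) mf).
have h2 p : D1 p -> F ^~ p @ \oo --> (f p)%:E.
  move=> p1; have [k hk] := ltr_add_invr p1.
  apply: cvg_near_cst; exists k => // n /= kn.
  rewrite /F patchE mem_set//= /subdisc/= /r lerBrDr (le_trans _ (ltW hk))// lerD2l.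
  by rewrite lef_pV2 ?posrE// ler_nat ltnS.
have h3 p : D1 p -> `|(f p)%:E|%E \is a fin_num by [].
have h4 : mu.-integrable D1 (fun p => `|(f p)%:E|%E).
  exact: (@integrable_abse _ RR).
have h5 n p : D1 p -> (`|F n p| <= `|(f p)%:E|)%E.
  by move=> _; rewrite /F patchE; case: ifP => //; rewrite abse0.
have cv := @dominated_cvg _ RR R mu D1 measurable_disc2 F _ _ h1 h2 h3 h4 h5.
have E : (fun n => \int[mu]_(p in D1) F n p)%E = (fun=> 0%E).
  apply/funext => n; rewrite -(f0 _ (r1 n)) /F.
  rewrite -(@integral_mkcondr _ RR).
  by rewrite setIidr//; exact: subdisc_sub.
have c0 := eq_ind _ (fun F : nat -> \bar R => F @ \oo --> _) cv _ E.
by rewrite -(cvg_lim (@ereal_hausdorff R) c0); apply/cvg_lim; [exact: ereal_hausdorff|exact: cvg_cst].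
Qed.

Lemma measurableC_power_series g a : power_series_on_disc g a ->
  measurableC D1 (fun p => g (toC p)).
Proof.
move=> ga.
split.
  apply: (@measurable_fun_cvg _ _ R D1 (fun N p => complex.Re ((\sum_(k < N) a k * toC p ^+ k) * 1))).
    move=> N; under eq_fun do rewrite mulr1.
    by have [] := measurableC_psum D1 a N.
  move=> p p1; rewrite -[g _]mulr1.
  exact: (psum_Re_cvg g a 1 _ ga (cabs_toC_lt1 _ p1)).
have ImE (z : R[i]) : complex.Im z = complex.Re (z * (0 -i* 1)).
  by case: z => x y /=; ring.
apply: (@measurable_fun_cvg _ _ R D1 (fun N p => complex.Re ((\sum_(k < N) a k * toC p ^+ k) * (0 -i* 1)))).
  move=> N; under eq_fun do rewrite -ImE.
  by have [] := measurableC_psum D1 a N.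
move=> p p1; rewrite ImE.
exact: (psum_Re_cvg g a _ _ ga (cabs_toC_lt1 _ p1)).
Qed.

Lemma integrable_wcabs2 g a : power_series_on_disc g a ->
  (bergman_norm2 alpha g < +oo)%E ->
  mu.-integrable D1 (fun p => (w p * cabs2 (g (toC p)))%:E).
Proof.
move=> ga gfin; apply/integrableP; split.
  apply/measurable_EFinP; apply: measurable_funM.
    by apply: measurable_funTS; exact: measurable_weight.
  by apply: measurableC_cabs2; exact: measurableC_power_series ga.
apply: le_lt_trans gfin; rewrite le_eqVlt; apply/orP; left; apply/eqP.
apply: eq_integral => p _ /=.
by rewrite ger0_norm// mulr_ge0 ?cabs2_ge0// weight_ge0.
Qed.

(** On the disc, [|g * conjc (z ^+ l)| <= |g| <= 1 + |g|^2], and both summands are integrable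
    against the weight. *)
Lemma integrable_wRe_monomial g a l : power_series_on_disc g a ->
  (bergman_norm2 alpha g < +oo)%E ->
  mu.-integrable D1 (EFin \o wRe alpha (fun z => g z * conjc (z ^+ l))).
Proof.
move=> ga gfin.
have i1 := integrable_wcabs2 g a ga gfin.
have i2 := integrable_weight alpha alphaN1.
have i3 := @integrableD _ RR R mu _ measurable_disc2 _ _ i2 i1.
apply: (@le_integrable _ RR R mu _ measurable_disc2 _ _ _ _ i3).
  apply/measurable_EFinP; apply: measurable_funM.
    by apply: measurable_funTS; exact: measurable_weight.
  have [] // := @measurableC_mul R D1 (fun p => g (toC p)) (fun p => conjc (toC p ^+ l)).
    exact: measurableC_power_series ga.
  by apply: measurableC_conj; apply: measurableC_exp; exact: measurableC_toC.
move=> p p1; rewrite /= lee_fin.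
have w0 := weight_ge0 _ alphaN1 p.
have c0 := cabs2_ge0 (g (toC p)).
have -> : w p + w p * cabs2 (g (toC p)) = w p * (1 + cabs2 (g (toC p))) by ring.
rewrite [leRHS]ger0_norm; last by rewrite mulr_ge0// addr_ge0.
rewrite normrM ger0_norm// ler_wpM2l//.
apply: le_trans (normr_Re_le _) _; rewrite cabsM cabs_conj cabsX.
apply: (@le_trans _ _ (cabs (g (toC p)))).
  apply: ler_piMr; first exact: cabs_ge0.
  by apply: exprn_ile1; [exact: cabs_ge0|exact/ltW/cabs_toC_lt1].
by rewrite -cabs_sqr; have := cabs_ge0 (g (toC p)); nra.
Qed.

Lemma integrable_wReX (c : R[i]) k l :
  mu.-integrable D1 (EFin \o wRe alpha (fun z => c * z ^+ k * conjc (z ^+ l))).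
Proof.
apply: (integrable_weight_le alpha alphaN1 D1
  (fun p => complex.Re (c * toC p ^+ k * conjc (toC p ^+ l))) (cabs c) measurable_disc2
  (fun _ => id)).
  have [] // := @measurableC_mul R D1 (fun p => c * toC p ^+ k) (fun p => conjc (toC p ^+ l)).
    by apply: measurableC_mul; [exact: measurableC_cst|apply: measurableC_exp; exact: measurableC_toC].
  by apply: measurableC_conj; apply: measurableC_exp; exact: measurableC_toC.
by move=> p p1; apply: normr_Re_monomial_le; apply: ltW; exact: cabs_toC_lt1.
Qed.

Lemma integral_wRe_diag (c : R[i]) l :
  (\int[mu]_(p in D1) (wRe alpha (fun z => c * z ^+ l * conjc (z ^+ l)) p)%:E =
   (complex.Re c * moment alpha l)%:E)%E.
Proof.
transitivity (\int[mu]_(p in D1) ((complex.Re c)%:E * (w p * sqnorm p ^+ l)%R%:E))%E.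
  apply: eq_integral => p _; rewrite -EFinM; congr EFin.
  rewrite mulrCA; congr (_ * _).
  rewrite -mulrA mulcJ.
  have -> : cabs2 (toC p ^+ l) = sqnorm p ^+ l.
    by elim: l => [|k IH]; rewrite ?expr0 ?exprS ?cabs2M ?IH// /cabs2/= expr1n expr0n addr0.
  by case: c => x y; rewrite /= mulr0 subr0.
rewrite (@integralZl _ RR R mu D1 measurable_disc2).
  by rewrite integral_weight_sqnorm.
apply: (integrable_weight_le alpha alphaN1 D1 (fun p => sqnorm p ^+ l) 1 measurable_disc2
  (fun _ => id)).
  by apply: measurable_funTS; apply: measurable_funX; exact: measurable_sqnorm.
move=> p p1; rewrite ger0_norm ?exprn_ge0 ?sqnorm_ge0// exprn_ile1 ?sqnorm_ge0//.
exact: ltW p1.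
Qed.

(** Subtracting [a l * z ^+ l] from [g] leaves a series with vanishing coefficient at [l], hence a
    zero integral; only the diagonal monomial contributes. *)
Lemma integral_wRe_coef g a l : power_series_on_disc g a ->
  (bergman_norm2 alpha g < +oo)%E ->
  (\int[mu]_(p in D1) (wRe alpha (fun z => g z * conjc (z ^+ l)) p)%:E =
   (complex.Re (a l) * moment alpha l)%:E)%E.
Proof.
move=> ga gfin.
pose h z := g z + - a l * z ^+ l.
pose b k := a k + (if k == l then - a l else 0).
have hb : power_series_on_disc h b.
  apply: power_series_add => //.
  have := power_series_mulX _ _ l (power_series_cst (- a l)).
  rewrite (_ : (fun z => z ^+ l * - a l) = (fun z => - a l * z ^+ l)); last first.
    by apply/funext => z; rewrite mulrC.
  apply: power_series_ext => k; case: ltngtP => [//|lk|->]; last by rewrite subnn.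
  by rewrite subn_eq0 leqNgt lk.
have i1 := integrable_wRe_monomial g a l ga gfin.
have i2 := integrable_wReX (- a l) l l.
have e p : wRe alpha (fun z => h z * conjc (z ^+ l)) p =
  wRe alpha (fun z => g z * conjc (z ^+ l)) p + wRe alpha (fun z => - a l * z ^+ l * conjc (z ^+ l)) p.
  by rewrite -wReD; congr (_ * complex.Re _); rewrite -mulrDl.
pose u1 := wRe alpha (fun z => g z * conjc (z ^+ l)).
pose u2 := wRe alpha (fun z => - a l * z ^+ l * conjc (z ^+ l)).
have i3 : mu.-integrable D1 (EFin \o wRe alpha (fun z => h z * conjc (z ^+ l))).
  rewrite (_ : _ \o _ = (EFin \o u1) \+ (EFin \o u2))%E.
    exact: (@integrableD _ RR R mu _ measurable_disc2 _ _ i1 i2).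
  by apply/funext => p; rewrite /= e EFinD.
have h0 : (\int[mu]_(p in D1) (wRe alpha (fun z => h z * conjc (z ^+ l)) p)%:E = 0)%E.
  apply: integral_disc_exhaustion => // s s1.
  by apply: integral_subdisc_eq0 hb _ s1 => //; rewrite /b eqxx subrr.
have := @integralD _ RR R mu _ measurable_disc2 _ _ i1 i2.
have -> : (\int[mu]_(p in D1) ((EFin \o u1) p + (EFin \o u2) p) = 0)%E.
  by rewrite -h0; apply: eq_integral => p _; rewrite e EFinD.
rewrite [X in (_ + X)%E]integral_wRe_diag.
have f1 := @integrable_fin_num _ RR R mu _ measurable_disc2 _ i1.
have aux (J : \bar R) (x y : R) : J \is a fin_num -> (0 = J + (x * y)%:E)%E -> J = (- x * y)%:E.
  by move=> /fineK <-; rewrite -EFinD => -[] h1; congr EFin; lra.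
move=> /(aux _ _ _ f1) ->; congr (_ * _)%:E.
by case: (a l) => x y /=; rewrite opprK.
Qed.

Lemma bergman_norm2_scale g a (c : R[i]) : power_series_on_disc g a ->
  (bergman_norm2 alpha g < +oo)%E ->
  (bergman_norm2 alpha (fun z => c * g z)%R < +oo)%E.
Proof.
move=> ga gfin; have i1 := integrable_wcabs2 g a ga gfin.
rewrite /bergman_norm2.
rewrite (_ : (\int[_]_(p in _) _ = (cabs2 c)%:E * bergman_norm2 alpha g)%E).
  by rewrite lte_mul_pinfty// lee_fin cabs2_ge0.
rewrite /bergman_norm2 -(@integralZl _ RR R mu _ measurable_disc2 _ i1).
by apply: eq_integral => p _; rewrite cabs2M -EFinM mulrCA.
Qed.

(** The factor [conjc 1] stands for [conjc (z ^+ 0)], so that both summands fit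
    [integral_wRe_coef]. *)
Lemma mul_conj_binomial (x u v y : R[i]) :
  x * conjc (u + v * y) = conjc u * x * conjc 1 + conjc v * x * conjc y.
Proof.
by case: x u v y => [x1 x2] [u1 u2] [v1 v2] [y1 y2]; simpc; congr Complex; ring.
Qed.

(** Taking real parts does not commute with complex scalars, so [conjc u] and [conjc v] are absorbed
    into [g] before its coefficients at 0 and [m] are read off. *)
Lemma integral_wRe_binomial g b (u v : R[i]) m : (0 < m)%N ->
  power_series_on_disc g b -> (bergman_norm2 alpha g < +oo)%E ->
  (\int[mu]_(p in D1) (wRe alpha (fun z => g z * conjc (u + v * z ^+ m))%R p)%:E =
   (complex.Re (b 0%N * conjc u + (moment alpha m)%:C * (b m * conjc v)))%R%:E)%E.
Proof.
move=> m0 gb gfin.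
pose g1 z := conjc u * g z; pose g2 z := conjc v * g z.
have s1 := power_series_scale g b (conjc u) gb.
have s2 := power_series_scale g b (conjc v) gb.
have n1 := bergman_norm2_scale g b (conjc u) gb gfin.
have n2 := bergman_norm2_scale g b (conjc v) gb gfin.
have i1 := integrable_wRe_monomial g1 _ 0%N s1 n1.
have i2 := integrable_wRe_monomial g2 _ m s2 n2.
have e p : wRe alpha (fun z => g z * conjc (u + v * z ^+ m)) p =
    wRe alpha (fun z => g1 z * conjc (z ^+ 0)) p + wRe alpha (fun z => g2 z * conjc (z ^+ m)) p.
  rewrite -wReD; congr (_ * complex.Re _); rewrite /g1 /g2 expr0.
  exact: mul_conj_binomial.
have := @integralD _ RR R mu _ measurable_disc2 _ _ i1 i2.
rewrite [X in (_ = X + _)%E](integral_wRe_coef _ _ 0%N s1 n1).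
rewrite [X in (_ = _ + X)%E](integral_wRe_coef _ _ m s2 n2) => h.
transitivity (\int[mu]_(p in D1) ((EFin \o wRe alpha (fun z => g1 z * conjc (z ^+ 0))%R) p +
  (EFin \o wRe alpha (fun z => g2 z * conjc (z ^+ m))%R) p))%E.
  by apply: eq_integral => p _; rewrite e EFinD.
rewrite h -EFinD moment0// mulr1; congr EFin.
case: (b 0%N) (b m) u v {s1 s2 n1 n2 i1 i2 e h g1 g2} => [a1 a2] [b1 b2] [u1 u2] [v1 v2] /=.
by ring.
Qed.

Lemma bergman_inner_binomial g b (u v : R[i]) m : (0 < m)%N ->
  power_series_on_disc g b -> (bergman_norm2 alpha g < +oo)%E ->
  bergman_inner alpha g (fun z => u + v * z ^+ m) =
  b 0%N * conjc u + (moment alpha m)%:C * (b m * conjc v).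
Proof.
move=> m0 gb gfin.
have hre := integral_wRe_binomial g b u v m m0 gb gfin.
(* The imaginary part of the inner product is the real part obtained from [-i * g]. *)
have him := integral_wRe_binomial _ _ u v m m0
  (power_series_scale g b (0 -i* 1) gb) (bergman_norm2_scale g b (0 -i* 1) gb gfin).
rewrite [RHS](_ : _ = complex.Re (b 0%N * conjc u + (moment alpha m)%:C * (b m * conjc v)) +i*
  complex.Re ((0 -i* 1) * b 0%N * conjc u + (moment alpha m)%:C * ((0 -i* 1) * b m * conjc v))).
  congr Complex; rewrite /Rintegral.
    by rewrite -[RHS]/(fine (_%:E)) -hre.
  rewrite -[RHS]/(fine (_%:E)) -him; congr fine; apply: eq_integral => p _.
  congr (_ * _)%:E; rewrite -mulrA -[Num.conj _]/(conjc _).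
  by case: (g _ * conjc _) => x y /=; ring.
case: (b 0%N) (b m) u v {hre him} => [a1 a2] [b1 b2] [u1 u2] [v1 v2] /=.
by congr Complex; simpc; ring.
Qed.

Lemma power_series_binomial (u v : R[i]) m : power_series_on_disc (fun z => u + v * z ^+ m)
  (fun k => (if k == 0%N then u else 0) +
            (if (k < m)%N then 0 else if (k - m)%N == 0%N then v else 0)).
Proof.
apply: power_series_add; first exact: power_series_cst.
have := power_series_mulX _ _ m (power_series_cst v).
by under eq_fun do rewrite mulrC.
Qed.

Lemma bergman_norm2_binomial (u v : R[i]) m : (0 < m)%N ->
  bergman_norm2 alpha (fun z => u + v * z ^+ m) =
  (cabs2 u + moment alpha m * cabs2 v)%:E.
Proof.
move=> m0; have fs := power_series_binomial u v m.
have fin : (bergman_norm2 alpha (fun z => u + v * z ^+ m)%R < +oo)%E.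
  have i1 := integrable_weight_le alpha alphaN1 D1
    (fun p => cabs2 (u + v * toC p ^+ m)) ((cabs u + cabs v) ^+ 2) measurable_disc2
    (fun _ => id) (measurableC_cabs2 _ _ (measurableC_power_series _ _ fs)).
  apply: (@integrable_lty _ RR R mu _ measurable_disc2); apply: i1 => p p1.
  rewrite ger0_norm ?cabs2_ge0// -cabs_sqr ler_sqr ?nnegrE ?addr_ge0 ?cabs_ge0//.
  apply: le_trans (cabs_le_add _ _) _; rewrite lerD2l cabsM cabsX.
  apply: ler_piMr; first exact: cabs_ge0.
  by apply: exprn_ile1; [exact: cabs_ge0|exact/ltW/cabs_toC_lt1].
transitivity (\int[mu]_(p in D1)
    (wRe alpha (fun z => (u + v * z ^+ m) * conjc (u + v * z ^+ m))%R p)%:E)%E.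
  by apply: eq_integral => p _; congr (_ * _)%:E; rewrite mulcJ.
rewrite (integral_wRe_binomial _ _ u v m m0 fs fin) /= eqn0Ngt m0/= ltnn subnn eqxx.
rewrite addr0 add0r !mulcJ; congr EFin; rewrite /=; ring.
Qed.

End bergman_inner_products.

(** * The ellipse inside the numerical range *)

Lemma expi_2piM {R : realType} (k : nat) : expi (k%:R * (2 * pi) : R) = 1.
Proof.
rewrite -expiX (_ : 2 * pi = pi + pi); last by ring.
by rewrite expiD expi_pi mulrNN mulr1 expr1n.
Qed.

Theorem theorem5p5 (R : realType) (alpha : R) (n : nat)
    (psi : R[i] -> R[i]) (psihat : nat -> R[i]) (p j : nat) :
  -1 < alpha -> (0 < n)%N ->
  power_series_on_disc psi psihat ->
  bounded_on_bergman alpha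
    (wcomp psi (fun z => expi (2 * pi / n%:R) * z)) ->
  (0 < j)%N -> (j < n)%N ->
  psihat (n * p + j)%N != 0 ->
  let lambda := expi (2 * pi / n%:R) in
  let m := (n * p + j)%N in
  let c := (m`!)%:R * Gamma (alpha + 2) / Gamma (m%:R + alpha + 2) in
  let L := Num.sqrt (cabs2 (psihat 0%N) * cabs2 (1 - expi (2 * pi * j%:R / n%:R))
                     + c * cabs2 (psihat m)) in
  closed_ellipse (psihat 0%N) (lambda ^+ m * psihat 0%N) L
    `<=` numerical_range alpha (wcomp psi (fun z => lambda * z)) /\
  ellipse_minor_axis (psihat 0%N) (lambda ^+ m * psihat 0%N) L
    = Num.sqrt c * cabs (psihat m).
Proof.
move=> aN1 n0 psis Tb j0 jn psim lambda m c L.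
have m0 : (0 < m)%N by rewrite /m addn_gt0 j0 orbT.
have c0 : 0 < c by exact: moment_gt0.
pose a := psihat 0%N; pose b := lambda ^+ m * psihat 0%N.
(* As [c] is the squared norm of [z ^+ m], the image of 1 has inner product
   [c * psihat m / Num.sqrt c] with the normalized monomial. *)
pose d := (Num.sqrt c)%:C * psihat m.
have sc0 : Num.sqrt c != 0 by rewrite sqrtr_eq0 -ltNge.
have sc0' : (Num.sqrt c)%:C != 0 :> R[i] by rewrite eq_complex/= eqxx andbT.
(* The exponent [n * p] contributes only full turns. *)
have lambdam : lambda ^+ m = expi (2 * pi * j%:R / n%:R).
  rewrite /lambda expiX (_ : _ * _ = p%:R * (2 * pi) + 2 * pi * j%:R / n%:R).
    by rewrite expiD expi_2piM mul1r.
  by rewrite /m natrD natrM; field; rewrite pnatr_eq0 -lt0n.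
have dE : cabs2 d = c * cabs2 (psihat m).
  rewrite cabs2M; congr (_ * _).
  by rewrite /cabs2/= expr0n addr0 sqr_sqrtr// ltW.
have abE : cabs2 (a - b) = cabs2 (psihat 0%N) * cabs2 (1 - expi (2 * pi * j%:R / n%:R)).
  by rewrite -cabs2M -lambdam /a /b; congr cabs2; ring.
have LE : L = Num.sqrt (cabs2 (a - b) + cabs2 d) by rewrite /L dE abE.
split; last first.
  rewrite /ellipse_minor_axis LE sqr_sqrtr; last by rewrite addr_ge0 ?cabs2_ge0.
  by rewrite -/a -/b addrAC subrr add0r dE sqrtrM// ltW.
move=> z; rewrite /closed_ellipse/= LE => hz.
have d0 : d != 0 by rewrite mulf_neq0.
have [u [V [uV zE]]] := elliptic_range a b d z d0 hz.
(* [V] is the coordinate along the normalized monomial; [v] is the resulting coefficient of [z ^+ m]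
   itself. *)
pose v := V / (Num.sqrt c)%:C.
have vE : V = v * (Num.sqrt c)%:C by rewrite divfK.
have cE : c%:C = (Num.sqrt c)%:C * (Num.sqrt c)%:C :> R[i].
  by rewrite -rmorphM/= -expr2 sqr_sqrtr// ltW.
pose f x := u + v * x ^+ m : R[i].
have fs := power_series_binomial u v m.
have fn : bergman_norm2 alpha f = 1%:E.
  rewrite bergman_norm2_binomial// -uV vE cabs2M -/c; congr (_ + _)%:E.
  rewrite mulrC -/(moment alpha m) -/c {3}/cabs2/= expr0n addr0 sqr_sqrtr//; exact: ltW.
have fb : in_bergman alpha f.
  by split; [eexists; exact: fs|rewrite fn ltry].
(* Boundedness supplies the finite norm of the image of [f], which the inner product formula
   requires. *)
have [M hM] := Tb; have [[_ Tfin] _] := hM f fb.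
exists f; first by split.
(* Coefficients of [u * psi + v * lambda ^+ m * z ^+ m * psi]. Only those at 0 and [m] enter:
   [u * psihat 0] and [u * psihat m + v * lambda ^+ m * psihat 0]. *)
pose Tc k := u * psihat k + (if (k < m)%N then 0 else v * lambda ^+ m * psihat (k - m)%N).
have Ts : power_series_on_disc (wcomp psi (fun z => lambda * z) f) Tc.
  have h1 := power_series_scale _ _ u psis.
  have h2 := power_series_mulX _ _ m (power_series_scale _ _ (v * lambda ^+ m) psis).
  have := power_series_add _ _ _ _ h1 h2.
  rewrite (_ : (fun z => _) = wcomp psi (fun z => lambda * z) f)//.
  by apply/funext => x; rewrite /wcomp /f exprMn; ring.
rewrite (bergman_inner_binomial alpha aN1 _ Tc u v m m0 Ts Tfin).
have eV : conjc (v * (Num.sqrt c)%:C) = conjc v * (Num.sqrt c)%:C.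
  by case: {+}v => v1 v2; simpc; congr Complex; ring.
rewrite -/(moment alpha m) -/c zE /Tc m0 ltnn subnn vE eV cE /d /b /a.
by ring.
Qed.
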